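(* Every Lie super-bialgebra structure $(\mathfrak{L},[\cdot,\cdot],\Delta)$ on the generalized super $W$-algebra $\mathfrak{L}$ is triangular coboundary. That is, there exists $r\in\mathrm{Im}(1\otimes1-\tau)\subset\mathfrak{L}\otimes\mathfrak{L}$ such that: - $\Delta(x)=(-1)^{[r][x]}x\circ r$ for all $x\in\mathfrak{L}$, and - $r$ satisfies the classical Yang–Baxter equation $c(r)=0$.
   Context: Let $\Gamma$ be a nontrivial additive subgroup of $\mathbb{R}$, and let $s\in\mathbb{R}$ with $2s\in\Gamma$. The Lie superalgebra $\mathfrak{L}$ over $\mathbb{C}$ has basis $\{L_p,I_p,G_r,H_r\mid p\in\Gamma,\ r\in s+\Gamma\}$. Here $L_p,I_p$ are even and $G_r,H_r$ are odd. The nonzero super-brackets are $[L_p,L_q]=(p-q)L_{p+q}$, $[L_p,I_q]=(p-q)I_{p+q}$, $[L_p,G_r]=(\tfrac p2-r)G_{p+r}$, $[L_p,H_r]=(\tfrac p2-r)H_{p+r}$, $[G_r,G_t]=I_{r+t}$, $[I_p,G_r]=(p-2r)H_{p+r}$. All other brackets of basis elements vanish, apart from those forced by super-antisymmetry. Conventions: - $[x]\in\mathbb{Z}_2$ is the parity of a homogeneous $x$. - $\tau(x\otimes y)=(-1)^{[x][y]}y\otimes x$ is the super-twist. - $\xi(x_1\otimes x_2\otimes x_3)=(-1)^{[x_1]([x_2]+[x_3])}x_2\otimes x_3\otimes x_1$ is the super-cyclic map. - The adjoint diagonal action is $x\circ(a\otimes b)=[x,a]\otimes b+(-1)^{[x][a]}a\otimes[x,b]$.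 A Lie super-coalgebra structure is a linear map $\Delta:\mathfrak{L}\to\mathfrak{L}\otimes\mathfrak{L}$ satisfying: - $\Delta$ preserves parity, - $\mathrm{Im}\Delta\subset\mathrm{Im}(1\otimes1-\tau)$, - $(1\otimes1\otimes1+\xi+\xi^2)(1\otimes\Delta)\Delta=0$. A Lie super-bialgebra structure additionally requires $\Delta([x,y])=x\circ\Delta(y)-(-1)^{[x][y]}y\circ\Delta(x)$ for all homogeneous $x,y$. For $r=\sum_i a_i\otimes b_i$ with homogeneous $a_i,b_i$, define $c(r)=\sum_{i,j}\Big((-1)^{[a_j][b_i]}[a_i,a_j]\otimes b_i\otimes b_j+a_i\otimes[b_i,a_j]\otimes b_j+(-1)^{[a_j][b_i]}a_i\otimes a_j\otimes[b_i,b_j]\Big)\in\mathfrak{L}^{\otimes3}$. The equation $c(r)=0$ is the classical Yang–Baxter equation. *)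

(* Defs.v *)
From Stdlib Require Import Reals List Bool.
Import ListNotations.
Open Scope R_scope.

Record Cx := mkCx { cre : R ; cim : R }.
Definition C0 : Cx := mkCx 0 0.
Definition C1 : Cx := mkCx 1 0.
Definition RC (x : R) : Cx := mkCx x 0.
Definition Cadd (z w : Cx) : Cx := mkCx (cre z + cre w) (cim z + cim w).
Definition Cmul (z w : Cx) : Cx :=
  mkCx (cre z * cre w - cim z * cim w) (cre z * cim w + cim z * cre w).

(* (KL,p) = L_p, (KI,p) = I_p, (KG,r) = G_r, (KH,r) = H_r *)
Inductive kind := KL | KI | KG | KH.
Definition basis : Type := (kind * R)%type.

(* parity: false = even, true = odd *)
Definition par (b : basis) : bool :=
  match fst b with KG | KH => true | _ => false end.

(* the basis elements actually belonging to L: p in Gamma, r in s + Gamma *)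
Definition valid (Gam : R -> Prop) (s : R) (b : basis) : Prop :=
  match fst b with
  | KL | KI => Gam (snd b)
  | KG | KH => Gam (snd b - s)
  end.

(* super-bracket of two basis elements: [a,b] = (fst (br a b)) * (snd (br a b)) *)
Definition br (a b : basis) : R * basis :=
  match a, b with
  | (KL, p), (KL, q) => (p - q, (KL, p + q))
  | (KL, p), (KI, q) => (p - q, (KI, p + q))
  | (KI, q), (KL, p) => (- (p - q), (KI, p + q))
  | (KL, p), (KG, r) => (p / 2 - r, (KG, p + r))
  | (KG, r), (KL, p) => (- (p / 2 - r), (KG, p + r))
  | (KL, p), (KH, r) => (p / 2 - r, (KH, p + r))
  | (KH, r), (KL, p) => (- (p / 2 - r), (KH, p + r))
  | (KG, r), (KG, t) => (1, (KI, r + t))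
  | (KI, p), (KG, r) => (p - 2 * r, (KH, p + r))
  | (KG, r), (KI, p) => (- (p - 2 * r), (KH, p + r))
  | _, _ => (0, (KL, 0))
  end.

Definition kind_eq_dec : forall x y : kind, {x = y} + {x <> y}.
Proof. decide equality. Defined.
Definition basis_eq_dec : forall x y : basis, {x = y} + {x <> y}.
Proof. decide equality; first [apply Req_EM_T | apply kind_eq_dec]. Defined.

Definition B2 : Type := (basis * basis)%type.
Definition B3 : Type := (basis * basis * basis)%type.
Definition B2_eq_dec : forall x y : B2, {x = y} + {x <> y}.
Proof. decide equality; apply basis_eq_dec. Defined.
Definition B3_eq_dec : forall x y : B3, {x = y} + {x <> y}.
Proof. decide equality; first [apply basis_eq_dec | apply B2_eq_dec]. Defined.

(* An element of L (resp. L(x)L, L(x)L(x)L) is a finite formal sum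
   sum_i c_i e_i with e_i in the basis (resp. pairs, triples of basis elements),
   i.e. L(x)L is identified with the free module on basis x basis.
   Two formal sums are equal iff all their coefficients agree. *)
Definition vec (T : Type) := list (Cx * T).

Definition coef {T : Type} (dec : forall x y : T, {x = y} + {x <> y})
  (v : vec T) (t : T) : Cx :=
  fold_right (fun e acc => if dec t (snd e) then Cadd (fst e) acc else acc) C0 v.

Definition coef2 := @coef B2 B2_eq_dec.
Definition coef3 := @coef B3 B3_eq_dec.
Definition equiv2 (v w : vec B2) : Prop := forall t, coef2 v t = coef2 w t.
Definition equiv3 (v w : vec B3) : Prop := forall t, coef3 v t = coef3 w t.

Definition scale {T : Type} (k : Cx) (v : vec T) : vec T :=
  map (fun e => (Cmul k (fst e), snd e)) v.
Definition vsub {T : Type} (v w : vec T) : vec T := v ++ scale (RC (-1)) w.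

Definition sgn (b : bool) : Cx := if b then RC (-1) else C1.

Definition in_LL (Gam : R -> Prop) (s : R) (v : vec B2) : Prop :=
  forall a b, coef2 v (a, b) <> C0 -> valid Gam s a /\ valid Gam s b.

Definition homog2 (v : vec B2) (p : bool) : Prop :=
  forall a b, coef2 v (a, b) <> C0 -> xorb (par a) (par b) = p.

Definition tau (v : vec B2) : vec B2 :=
  map (fun e => match e with (c, (a, b)) =>
         (Cmul (sgn (par a && par b)) c, (b, a)) end) v.

Definition xi (v : vec B3) : vec B3 :=
  map (fun e => match e with (c, (a, b, d)) =>
         (Cmul (sgn (par a && xorb (par b) (par d))) c, (b, d, a)) end) v.

Definition cyc (v : vec B3) : vec B3 := v ++ xi v ++ xi (xi v).

Definition in_im_1_tau (Gam : R -> Prop) (s : R) (v : vec B2) : Prop :=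
  exists u, in_LL Gam s u /\ equiv2 v (vsub u (tau u)).

(* A linear map Delta : L -> L (x) L is given by its values on the basis. *)
Definition comult := basis -> vec B2.

Definition one_tensor (D : comult) (v : vec B2) : vec B3 :=
  flat_map (fun e => match e with (c, (a, b)) =>
     map (fun f => match f with (c', (x, y)) => (Cmul c c', (a, x, y)) end) (D b)
  end) v.

Definition adj (x : basis) (v : vec B2) : vec B2 :=
  flat_map (fun e => match e with (c, (a, b)) =>
     let (k1, e1) := br x a in
     let (k2, e2) := br x b in
     [ (Cmul (RC k1) c, (e1, b)) ;
       (Cmul (sgn (par x && par a)) (Cmul (RC k2) c), (a, e2)) ]
  end) v.

Definition Delta_br (D : comult) (x y : basis) : vec B2 :=
  scale (RC (fst (br x y))) (D (snd (br x y))).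

Definition cybe (r : vec B2) : vec B3 :=
  flat_map (fun ei => match ei with (ci, (ai, bi)) =>
    flat_map (fun ej => match ej with (cj, (aj, bj)) =>
      let c := Cmul ci cj in
      let (k1, e1) := br ai aj in
      let (k2, e2) := br bi aj in
      let (k3, e3) := br bi bj in
      [ (Cmul (sgn (par aj && par bi)) (Cmul (RC k1) c), (e1, bi, bj)) ;
        (Cmul (RC k2) c, (ai, e2, bj)) ;
        (Cmul (sgn (par aj && par bi)) (Cmul (RC k3) c), (ai, aj, e3)) ]
    end) r
  end) r.

Definition is_lie_super_coalgebra (Gam : R -> Prop) (s : R) (D : comult) : Prop :=
  (forall b, valid Gam s b -> in_LL Gam s (D b)) /\
  (forall b, valid Gam s b -> homog2 (D b) (par b)) /\
  (forall b, valid Gam s b -> in_im_1_tau Gam s (D b)) /\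
  (forall b, valid Gam s b -> equiv3 (cyc (one_tensor D (D b))) []).

Definition is_lie_super_bialgebra (Gam : R -> Prop) (s : R) (D : comult) : Prop :=
  is_lie_super_coalgebra Gam s D /\
  (forall x y, valid Gam s x -> valid Gam s y ->
     equiv2 (Delta_br D x y)
            (vsub (adj x (D y)) (scale (sgn (par x && par y)) (adj y (D x))))).

Definition is_triangular_coboundary (Gam : R -> Prop) (s : R) (D : comult) : Prop :=
  exists (r : vec B2) (pr : bool),
    in_LL Gam s r /\ homog2 r pr /\ in_im_1_tau Gam s r /\
    (forall x, valid Gam s x -> equiv2 (D x) (scale (sgn (pr && par x)) (adj x r))) /\
    equiv3 (cybe r) [].

(* Main.v *)
(** Only the operators L_p are needed to make the cocycle inner.  Subtracting an inner
    cocycle built from Delta(L_0) makes Delta homogeneous of degree 0.  Fix e > 0 in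
    Gamma.  The degree-0 part of a tensor product of two density modules is a group
    algebra C[u^x], and for a coboundary f of g one has
    f_2e - (1 + u^e) f_e = a e (1 - u^e)^2 g.  The cocycle identity for (e, -e) and
    (2e, -e) shows that the moments of order 0 and 1 of the left-hand side vanish on each
    coset of Ze, so g exists for any cocycle f.  After subtracting it,
    f_2e = (1 + u^e) f_e, and the lowest coefficient of f_5e forces f = 0 on positive
    multiples of e.  What remains is equivariant under the L_ne with n >= 1, hence 0 by
    finiteness of supports; I and H are brackets of L and G.

    For the Yang-Baxter equation, c(r) is the cyclic sum of T(r,r), where
    T(a (x) b, c (x) d) = a (x) [b,c] (x) d, and L_p o c(r) is the cyclic sum of
    (1 (x) Delta) Delta(L_p), which is 0.  The cube of L has no invariants. *)

(* Each degree of L (x) L is infinite-dimensional and Gamma may be dense in R, so no dimension count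
   is available: every step either uses the finiteness of supports or works on one coset of Ze at a
   time. Each of the four kinds spans a density module over the L_p, of weight 1 or 1/2, and an even
   tensor has two factors of equal weight. Hence a single weight a occurs, and its positivity
   justifies the divisions by a, 2a + 1 and 2a + 2 and makes the final quadratic form definite. The
   combination f_2e - (1 + u^e) f_e is chosen because, for a coboundary, all multiplications by the
   position cancel in it and a constant-coefficient operator remains. Degree 5e is the lowest one in
   which two different brackets of positive operators meet, [L_4e, L_e] and [L_3e, L_2e], so it
   carries the first constraint on f_e and f_2e. The structure constants being real, the real and
   imaginary parts of Delta are separate cocycles. *)
Require Import Defs.
From Stdlib Require Import Reals List Bool.
From Stdlib Require Import Nsatz Lra Lia ZArith Classical ClassicalEpsilon.
Import ListNotations.
(* Reals also exports a constant [C1]. *)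
Import Defs.
Open Scope R_scope.

(** * Formal sums and their pairings *)

(* Formal sums are compared through their pairings with all weight functions [w]; a linear
   operation on sums then becomes its transpose on weights (suffix T). *)
Definition rpair {T : Type} (w : T -> R) (l : list (R * T)) : R :=
  fold_right (fun e acc => fst e * w (snd e) + acc) 0 l.

Definition dirac {T : Type} (t t' : T) : R :=
  if excluded_middle_informative (t = t') then 1 else 0.

Lemma dirac_same {T : Type} (t : T) : dirac t t = 1.
Proof. unfold dirac; destruct (excluded_middle_informative _); congruence. Qed.

Lemma dirac_neq {T : Type} (t t' : T) : t <> t' -> dirac t t' = 0.
Proof. unfold dirac; destruct (excluded_middle_informative _); congruence. Qed.

Lemma rpair_app {T : Type} (w : T -> R) l l' :
  rpair w (l ++ l') = rpair w l + rpair w l'.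
Proof. induction l as [|[c t] l IH]; simpl; [ring|]. unfold rpair in *; simpl. rewrite IH; ring. Qed.

Lemma rpair_cons {T : Type} (w : T -> R) c t l :
  rpair w ((c, t) :: l) = c * w t + rpair w l.
Proof. reflexivity. Qed.

Lemma rpair_ext_in {T : Type} (w w' : T -> R) l :
  (forall c t, In (c, t) l -> w t = w' t) -> rpair w l = rpair w' l.
Proof.
  induction l as [|[c t] l IH]; intros H; [reflexivity|].
  rewrite !rpair_cons, IH, (H c t); [reflexivity | now left |].
  intros c' t' Hin; apply (H c'); now right.
Qed.

Lemma rpair_ext {T : Type} (w w' : T -> R) l :
  (forall t, w t = w' t) -> rpair w l = rpair w' l.
Proof. intros H; apply rpair_ext_in; auto. Qed.

Lemma rpair_lin {T : Type} (a b : R) (w w' : T -> R) l :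
  rpair (fun t => a * w t + b * w' t) l = a * rpair w l + b * rpair w' l.
Proof.
  induction l as [|[c t] l IH]; [unfold rpair; simpl; ring|].
  rewrite !rpair_cons, IH; ring.
Qed.

Lemma rpair_scal {T : Type} (a : R) (w : T -> R) l :
  rpair (fun t => a * w t) l = a * rpair w l.
Proof.
  induction l as [|[c t] l IH]; [unfold rpair; simpl; ring|].
  rewrite !rpair_cons, IH; ring.
Qed.

Lemma rpair_zero {T : Type} (w : T -> R) l :
  (forall c t, In (c, t) l -> w t = 0) -> rpair w l = 0.
Proof.
  intros H. rewrite (rpair_ext_in w (fun t => 0 * w t)), rpair_scal; [ring|].
  intros c t Hin. rewrite (H c t Hin). ring.
Qed.

Lemma rpair_map {T U : Type} (m : T -> R) (h : T -> U) (w : U -> R) l :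
  rpair w (map (fun e => (m (snd e) * fst e, h (snd e))) l)
  = rpair (fun t => m t * w (h t)) l.
Proof.
  induction l as [|[c t] l IH]; [reflexivity|].
  simpl map. rewrite !rpair_cons, IH; simpl; ring.
Qed.

Lemma sum_dirac {T : Type} (w : T -> R) (t : T) (S : list T) :
  NoDup S ->
  fold_right (fun s acc => dirac s t * w s + acc) 0 S
  = if excluded_middle_informative (In t S) then w t else 0.
Proof.
  induction S as [|s S IH]; intros HS; simpl.
  - destruct (excluded_middle_informative False); tauto.
  - inversion HS; subst. rewrite IH by assumption.
    destruct (classic (s = t)) as [->|Hne].
    + rewrite dirac_same.
      destruct (excluded_middle_informative (In t S)); [tauto|].
      destruct (excluded_middle_informative (t = t \/ In t S)) as [_|n']; [ring|].
      exfalso; apply n'; now left.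
    + rewrite dirac_neq by assumption.
      destruct (excluded_middle_informative (In t S)), (excluded_middle_informative (s = t \/ In t S));
        try ring; tauto.
Qed.

(** A list may repeat a basis element with cancelling coefficients, so the sum is regrouped over a
    duplicate-free list. *)
Lemma rpair_expand {T : Type} (w : T -> R) (S : list T) :
  NoDup S -> forall l, (forall c t, In (c, t) l -> In t S) ->
  rpair w l = fold_right (fun s acc => rpair (dirac s) l * w s + acc) 0 S.
Proof.
  intros HS l; induction l as [|[c t] l IH]; intros Hl.
  - clear; induction S as [|s S IH]; simpl; [reflexivity|]. simpl in IH. rewrite <- IH.
    unfold rpair; simpl; ring.
  - rewrite rpair_cons, IH by (intros; apply (Hl c0); now right).
    assert (Ht : In t S) by (apply (Hl c); now left).
    assert (E := sum_dirac w t S HS).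
    destruct (excluded_middle_informative (In t S)); [|tauto].
    rewrite <- E. clear.
    induction S as [|s S IH]; cbn [fold_right]; [ring|].
    rewrite <- IH, rpair_cons. ring.
Qed.

Lemma rpair_supp {T : Type} (w : T -> R) (l : list (R * T)) :
  (forall t, rpair (dirac t) l = 0 \/ w t = 0) -> rpair w l = 0.
Proof.
  intros H.
  pose (dec := fun x y : T => excluded_middle_informative (x = y)).
  rewrite (rpair_expand w (nodup dec (map snd l))).
  - induction (nodup dec (map snd l)) as [|s S IH]; simpl; [reflexivity|].
    rewrite IH. destruct (H s) as [-> | ->]; ring.
  - apply NoDup_nodup.
  - intros c t Hin. apply nodup_In. now apply (in_map snd) in Hin.
Qed.

Lemma rpair_null {T : Type} (l : list (R * T)) :
  (forall t, rpair (dirac t) l = 0) -> forall w, rpair w l = 0.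
Proof. intros H w. apply rpair_supp. auto. Qed.

Lemma exists_minimal {T : Type} (m : T -> R) (P : T -> Prop) (l : list T) :
  (exists x, In x l /\ P x) ->
  exists x, In x l /\ P x /\ forall y, In y l -> P y -> m x <= m y.
Proof.
  induction l as [|a l IH]; intros (x & Hin & Hx); [destruct Hin|].
  destruct (classic (exists x, In x l /\ P x)) as [He|He].
  - destruct (IH He) as (z & Hz & Pz & Hmin).
    destruct (classic (P a /\ m a < m z)) as [[Pa Ha]|Ha].
    + exists a. repeat split; [now left|assumption|].
      intros y [<-|Hy] Py; [lra|]. specialize (Hmin y Hy Py). lra.
    + exists z. repeat split; [now right|assumption|].
      intros y [<-|Hy] Py; [|auto]. destruct (Rle_or_lt (m z) (m a)); [assumption|tauto].
  - destruct Hin as [<-|Hin]; [|exfalso; eauto].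
    exists a. repeat split; [now left|assumption|].
    intros y [<-|Hy] Py; [lra|]. exfalso; eauto.
Qed.

(** Provides the large p = ne that moves a tensor off its own finite support while L_p stays
    available. *)
Lemma exists_multiple_above (e : R) (S : list R) :
  0 < e -> exists n : Z, (1 <= n)%Z /\ forall x, In x S -> x < IZR n * e.
Proof.
  intros He. induction S as [|a S (n & Hn & IH)].
  - exists 1%Z. split; [lia|intros x []].
  - exists (Z.max n (up (a / e))). split; [lia|].
    assert (H1 : IZR n <= IZR (Z.max n (up (a / e)))) by (apply IZR_le; lia).
    assert (H2 : IZR (up (a / e)) <= IZR (Z.max n (up (a / e)))) by (apply IZR_le; lia).
    intros x [<-|Hx].
    + destruct (archimed (a / e)) as [Hu _].
      assert (a = a / e * e) by (field; lra). nra.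
    + specialize (IH x Hx). nra.
Qed.

(** * Cocycles of the Witt algebra in density modules *)

Definition rscale {T : Type} (a : R) (l : list (R * T)) : list (R * T) :=
  map (fun e => (a * fst e, snd e)) l.

Lemma rpair_rscale {T : Type} (w : T -> R) a l : rpair w (rscale a l) = a * rpair w l.
Proof.
  unfold rscale. rewrite (rpair_map (fun _ => a) (fun t => t)). apply rpair_scal.
Qed.

(** Transpose of multiplication by (1 - u)^2, where u is translation by e. *)
Definition second_diff (e : R) (w : R -> R) (x : R) : R := w x - 2 * w (x + e) + w (x + 2 * e).

(** Modulo (1 - u)^2 one has u^n = (1 - n) + n u. The quotient comes from u^(n+2) = 2 u^(n+1) - u^n
    + u^n (1 - u)^2, run upwards and downwards from n = 0, 1. *)
Lemma divide_monomial (e rho : R) (n : Z) :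
  exists G : list (R * R), forall w : R -> R,
    w (rho + IZR n * e)
    = (1 - IZR n) * w rho + IZR n * w (rho + e) + rpair (second_diff e w) G.
Proof.
  set (P := fun n : Z => exists G : list (R * R), forall w : R -> R,
    w (rho + IZR n * e)
    = (1 - IZR n) * w rho + IZR n * w (rho + e) + rpair (second_diff e w) G).
  assert (step : forall n,
    (P n /\ P (n + 1)%Z -> P (n + 2)%Z) /\ (P (n + 1)%Z /\ P (n + 2)%Z -> P n)).
  { intros m. split.
    - intros [[G1 H1] [G2 H2]].
      exists ((1, rho + IZR m * e) :: rscale 2 G2 ++ rscale (-1) G1).
      intros w. specialize (H1 w). specialize (H2 w).
      rewrite rpair_cons, rpair_app, !rpair_rscale. unfold second_diff at 1.
      rewrite plus_IZR in *.
      replace (rho + IZR m * e + e) with (rho + (IZR m + 1) * e) by ring.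
      replace (rho + IZR m * e + 2 * e) with (rho + (IZR m + 2) * e) by ring.
      rewrite H1, H2. ring.
    - intros [[G1 H1] [G2 H2]].
      exists ((1, rho + IZR m * e) :: rscale 2 G1 ++ rscale (-1) G2).
      intros w. specialize (H1 w). specialize (H2 w).
      rewrite rpair_cons, rpair_app, !rpair_rscale. unfold second_diff at 1.
      rewrite plus_IZR in *.
      replace (rho + IZR m * e + e) with (rho + (IZR m + 1) * e) by ring.
      replace (rho + IZR m * e + 2 * e) with (rho + (IZR m + 2) * e) by ring.
      rewrite H1, H2. ring. }
  assert (both : P n /\ P (n + 1)%Z).
  { induction n as [|n [IH1 IH2]|n [IH1 IH2]] using Z.peano_ind.
    - split; exists []; intros w; simpl; unfold rpair; simpl.
      + replace (rho + 0 * e) with rho by ring. ring.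
      + replace (rho + 1 * e) with (rho + e) by ring. ring.
    - replace (Z.succ n) with (n + 1)%Z by lia. split; [assumption|].
      replace (n + 1 + 1)%Z with (n + 2)%Z by lia. apply (proj1 (step n)); tauto.
    - replace (Z.pred n + 1)%Z with n by lia. split; [|assumption].
      apply (proj2 (step (Z.pred n))).
      replace (Z.pred n + 1)%Z with n by lia.
      replace (Z.pred n + 2)%Z with (n + 1)%Z by lia. tauto. }
  exact (proj1 both).
Qed.

(** For e > 0, [rem e y] is the representative in [0, e) of the coset y + Ze, so any function of it
    is e-periodic. *)
Definition quo (e y : R) : R := IZR (Int_part (y / e)).
Definition rem (e y : R) : R := y - quo e y * e.

Lemma quo_shift e y : 0 < e -> quo e (y + e) = quo e y + 1.
Proof.
  intros He. unfold quo. rewrite <- plus_IZR. f_equal. symmetry. apply Int_part_spec.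
  rewrite plus_IZR. destruct (base_Int_part (y / e)).
  replace ((y + e) / e) with (y / e + 1) by (field; lra). lra.
Qed.

Lemma rem_shift e y : 0 < e -> rem e (y + e) = rem e y.
Proof. intros He. unfold rem. rewrite quo_shift by assumption. ring. Qed.

Lemma divide_list {K : Type} (e : R) (h : list (R * (K * R))) :
  exists G : list (R * (K * R)), forall w : K * R -> R,
    rpair w h
    = rpair (fun t => (1 - quo e (snd t)) * w (fst t, rem e (snd t))
                      + quo e (snd t) * w (fst t, rem e (snd t) + e)) h
      + rpair (fun t => second_diff e (fun x => w (fst t, x)) (snd t)) G.
Proof.
  induction h as [|[c [k y]] h [G HG]].
  - exists []. intros w. unfold rpair; simpl; ring.
  - destruct (divide_monomial e (rem e y) (Int_part (y / e))) as [G1 H1].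
    exists (map (fun e0 => (c * fst e0, (k, snd e0))) G1 ++ G).
    intros w. rewrite !rpair_cons, rpair_app, HG; simpl.
    rewrite (rpair_map (fun _ => c) (fun x => (k, x))), rpair_scal; simpl.
    specialize (H1 (fun x => w (k, x))); simpl in H1.
    fold (quo e y) in H1.
    replace (rem e y + quo e y * e) with y in H1 by (unfold rem; ring).
    rewrite H1. change (fun t : R => second_diff e (fun x : R => w (k, x)) t)
      with (second_diff e (fun x => w (k, x))). ring.
Qed.

(* Divisibility by (1-u)^2 in the group algebra, where u is translation by e, is
   detected on each coset of Ze by the moments of order 0 and 1. *)
Lemma divide_of_moments {K : Type} (e : R) (h : list (R * (K * R))) :
  0 < e ->
  (forall kap : K * R -> R, (forall k x, kap (k, x + e) = kap (k, x)) ->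
     rpair kap h = 0 /\ rpair (fun t => snd t * kap t) h = 0) ->
  exists G : list (R * (K * R)), forall w : K * R -> R,
    rpair w h = rpair (fun t => second_diff e (fun x => w (fst t, x)) (snd t)) G.
Proof.
  intros He Hm. destruct (divide_list e h) as [G HG]. exists G. intros w.
  rewrite HG.
  (* The remainder of the division is the affine interpolation of w from its values at rem and rem +
     e. Written as k1 + y k2 with slope k2, its coefficients are periodic, so its pairing is a sum
     of two moments. *)
  set (k2 := fun t : K * R => / e * (w (fst t, rem e (snd t) + e) - w (fst t, rem e (snd t)))).
  set (k1 := fun t : K * R => w (fst t, rem e (snd t)) - rem e (snd t) * k2 t).
  destruct (Hm k1) as [M1 _].
  { intros k x; unfold k1, k2; simpl. now rewrite !rem_shift. }
  destruct (Hm k2) as [_ M2].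
  { intros k x; unfold k2; simpl. now rewrite !rem_shift. }
  rewrite (rpair_ext _ (fun t => 1 * k1 t + 1 * (snd t * k2 t))).
  - rewrite rpair_lin, M1, M2. ring.
  - intros [k y]; simpl. unfold k1, k2; simpl.
    replace (quo e y) with ((y - rem e y) / e) by (unfold rem; field; lra).
    field; lra.
Qed.

(* Transpose of the action of L_p on the degree-q part of a tensor product of two
   density modules with weight [al k], indexed by the position of the first factor. *)
Definition wittT {K : Type} (al : K -> R) (p q : R) (w : K * R -> R) : K * R -> R :=
  fun t => (al (fst t) * p - snd t) * w (fst t, snd t + p)
           + (al (fst t) * p - q + snd t) * w t.

Definition witt_cocycle {K : Type} (al : K -> R) (e : R) (f : Z -> list (R * (K * R))) :=
  forall m n w,
    (IZR m - IZR n) * e * rpair w (f (m + n)%Z)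
    = rpair (wittT al (IZR m * e) (IZR n * e) w) (f n)
      - rpair (wittT al (IZR n * e) (IZR m * e) w) (f m).

Lemma wittT_dirac {K : Type} (al : K -> R) p q k x l :
  rpair (wittT al p q (dirac (k, x))) l
  = ((al k + 1) * p - x) * rpair (dirac (k, x - p)) l
    + (al k * p - q + x) * rpair (dirac (k, x)) l.
Proof.
  rewrite <- rpair_lin. apply rpair_ext. intros [k' x']. unfold wittT; simpl.
  f_equal.
  - destruct (classic ((k, x) = (k', x' + p))) as [E|N].
    + inversion E; subst. replace (x' + p - p) with x' by ring. rewrite !dirac_same. ring.
    + rewrite !dirac_neq; [ring| |assumption].
      intros E; apply N; inversion E; subst. f_equal; ring.
  - destruct (classic ((k, x) = (k', x'))) as [E|N].
    + inversion E; subst. rewrite !dirac_same. ring.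
    + rewrite !dirac_neq by assumption. ring.
Qed.

Lemma cocycle_coef {K : Type} (al : K -> R) e f :
  witt_cocycle al e f -> forall m n s k x, s = (m + n)%Z ->
  (IZR m - IZR n) * e * rpair (dirac (k, x)) (f s)
  = ((al k + 1) * (IZR m * e) - x) * rpair (dirac (k, x - IZR m * e)) (f n)
    + (al k * (IZR m * e) - IZR n * e + x) * rpair (dirac (k, x)) (f n)
    - (((al k + 1) * (IZR n * e) - x) * rpair (dirac (k, x - IZR n * e)) (f m)
       + (al k * (IZR n * e) - IZR m * e + x) * rpair (dirac (k, x)) (f m)).
Proof. intros Hc m n s k x ->. rewrite Hc, !wittT_dirac. reflexivity. Qed.

(* Expanding f_5 both as [4,1] and as [3,2], the lowest coefficient F of f_1, at x,
   satisfies a (x^2 + (2a-3) x e + (a+1)(a+2) e^2) F = 0, a positive definite form. *)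
Lemma cocycle_bottom {K : Type} (al : K -> R) e f :
  0 < e -> (forall k, 1 / 2 <= al k) -> witt_cocycle al e f ->
  (forall w, rpair w (f 2%Z) = rpair (fun t => w t + w (fst t, snd t + e)) (f 1%Z)) ->
  forall w, rpair w (f 1%Z) = 0.
Proof.
  intros He Hal Hc H2. apply rpair_null. intros [k0 x0].
  destruct (classic (rpair (dirac (k0, x0)) (f 1%Z) = 0)) as [E|N0]; [exact E|exfalso].
  set (c := fun n x => rpair (dirac (k0, x)) (f n)).
  assert (Hin : forall x, c 1%Z x <> 0 -> In (k0, x) (map snd (f 1%Z))).
  { intros x Hx. apply NNPP. intros Hn. apply Hx. apply rpair_zero.
    intros d t Ht. apply dirac_neq. intros <-. apply Hn.
    now apply (in_map snd) in Ht. }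
  destruct (exists_minimal (fun t : K * R => snd t)
    (fun t => fst t = k0 /\ c 1%Z (snd t) <> 0) (map snd (f 1%Z)))
    as ([k x] & _ & [Ek Hx] & Hmin).
  { exists (k0, x0). split; [now apply Hin|]. simpl; split; [reflexivity|exact N0]. }
  simpl in Ek, Hx, Hmin. subst k.
  assert (B1 : forall y, y < x -> c 1%Z y = 0).
  { intros y Hy. apply NNPP. intros Hn. specialize (Hmin (k0, y) (Hin y Hn)).
    simpl in Hmin. assert (x <= y) by tauto. lra. }
  assert (C2 : forall y, c 2%Z y = c 1%Z y + c 1%Z (y - e)).
  { intros y. unfold c. rewrite H2.
    transitivity (1 * rpair (dirac (k0, y)) (f 1%Z) + 1 * rpair (dirac (k0, y - e)) (f 1%Z)); [|ring].
    rewrite <- rpair_lin. apply rpair_ext. intros [k' x']; simpl. rewrite !Rmult_1_l. f_equal.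
    destruct (classic ((k0, y) = (k', x' + e))) as [E|N].
    - inversion E; subst. replace (x' + e - e) with x' by ring. now rewrite !dirac_same.
    - rewrite !dirac_neq; [reflexivity| |assumption].
      intros E; apply N; inversion E; subst. f_equal; ring. }
  assert (B2 : forall y, y < x -> c 2%Z y = 0).
  { intros y Hy. rewrite C2, !B1 by lra. ring. }
  assert (D2 : c 2%Z x = c 1%Z x) by (rewrite C2, (B1 (x - e)) by lra; ring).
  assert (Q : forall m n s y, s = (m + n)%Z ->
    (IZR m - IZR n) * e * c s y
  = ((al k0 + 1) * (IZR m * e) - y) * c n (y - IZR m * e)
    + (al k0 * (IZR m * e) - IZR n * e + y) * c n y
    - (((al k0 + 1) * (IZR n * e) - y) * c m (y - IZR n * e)
       + (al k0 * (IZR n * e) - IZR m * e + y) * c m y)).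
  { intros. now apply cocycle_coef. }
  (* f_3 and f_4 are brackets of f_1 with f_2 and f_3, and positive operators never lower a
     position, so x bounds their supports below as well. *)
  assert (B3 : forall y, y < x -> c 3%Z y = 0).
  { intros y Hy. generalize (Q 2%Z 1%Z 3%Z y eq_refl).
    rewrite !B1, !B2 by lra. intros. nra. }
  assert (B4 : forall y, y < x -> c 4%Z y = 0).
  { intros y Hy. generalize (Q 3%Z 1%Z 4%Z y eq_refl).
    rewrite !B1, !B3 by lra. intros. nra. }
  generalize (Q 2%Z 1%Z 3%Z x eq_refl) (Q 3%Z 1%Z 4%Z x eq_refl)
    (Q 4%Z 1%Z 5%Z x eq_refl) (Q 3%Z 2%Z 5%Z x eq_refl).
  rewrite (B1 (x - 2 * e)), (B2 (x - 1 * e)), (B1 (x - 3 * e)), (B3 (x - 1 * e)),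
    (B1 (x - 4 * e)), (B4 (x - 1 * e)), (B2 (x - 3 * e)), (B3 (x - 2 * e)), D2 by lra.
  clear - He Hal Hx. specialize (Hal k0).
  set (F := c 1%Z x) in *. set (a := al k0) in *. generalize (c 3%Z x) (c 4%Z x) (c 5%Z x).
  intros F3 F4 F5 E3 E4 E5 E5'.
  assert (G3 : F3 = (1 + a) * F) by (apply Rmult_eq_reg_l with e; lra).
  subst F3.
  assert (T : e * a * (x * x + (2 * a - 3) * x * e + (a + 1) * (a + 2) * (e * e)) * F = 0).
  { nsatz. }
  apply Hx.
  assert (0 < x * x + (2 * a - 3) * x * e + (a + 1) * (a + 2) * (e * e)).
  (* Completing the square leaves (a+1)(a+2) - (a - 3/2)^2 = 6a - 1/4, positive because a >= 1/2. *)
  { assert (0 <= (x + (a - 3 / 2) * e) * (x + (a - 3 / 2) * e)) by apply Rle_0_sqr.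
    assert (0 < (6 * a - 1 / 4) * (e * e)) by (apply Rmult_lt_0_compat; nra). nra. }
  assert (0 < e * a * (x * x + (2 * a - 3) * x * e + (a + 1) * (a + 2) * (e * e))).
  { apply Rmult_lt_0_compat; [apply Rmult_lt_0_compat; lra|assumption]. }
  apply Rmult_integral in T. destruct T; [lra|assumption].
Qed.

Definition witt_act {K : Type} (al : K -> R) (p q : R) (g : list (R * (K * R)))
  : list (R * (K * R)) :=
  map (fun e => ((al (fst (snd e)) * p - snd (snd e)) * fst e,
                 (fst (snd e), snd (snd e) + p))) g
  ++ map (fun e => ((al (fst (snd e)) * p - q + snd (snd e)) * fst e, snd e)) g.

Lemma rpair_witt_act {K : Type} (al : K -> R) p q w g :
  rpair w (witt_act al p q g) = rpair (wittT al p q w) g.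
Proof.
  unfold witt_act. rewrite rpair_app.
  rewrite (rpair_map (fun t => al (fst t) * p - snd t) (fun t => (fst t, snd t + p))).
  rewrite (rpair_map (fun t => al (fst t) * p - q + snd t) (fun t => t)).
  rewrite <- (Rmult_1_l (rpair _ g)), <- (Rmult_1_l (rpair (fun t => (_ - q + _) * _) g)).
  rewrite <- rpair_lin. apply rpair_ext. intros t. unfold wittT. ring.
Qed.

Lemma wittT_bracket {K : Type} (al : K -> R) p q w t :
  (p - q) * wittT al (p + q) 0 w t
  = wittT al q 0 (wittT al p q w) t - wittT al p 0 (wittT al q p w) t.
Proof.
  destruct t as [k x]. unfold wittT; simpl.
  replace (x + (p + q)) with (x + q + p) by ring.
  replace (x + p + q) with (x + q + p) by ring. ring.
Qed.

(** L_e and L_2e generate all L_ne with n >= 1. The factor m - 1 in [L_me, L_e] vanishes at m = 1,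
    so index 2 has to be assumed. *)
Lemma cocycle_vanish {K : Type} (al : K -> R) e f :
  0 < e -> witt_cocycle al e f ->
  (forall w, rpair w (f 1%Z) = 0) -> (forall w, rpair w (f 2%Z) = 0) ->
  forall n, (1 <= n)%Z -> forall w, rpair w (f n) = 0.
Proof.
  intros He Hc H1 H2 n Hn.
  assert (S : forall m, (2 <= m)%Z -> (forall w, rpair w (f m) = 0) ->
                        forall w, rpair w (f (m + 1)%Z) = 0).
  { intros m Hm IH w. generalize (Hc m 1%Z w). rewrite H1, IH. intros E.
    assert (2 <= IZR m) by (apply IZR_le; lia).
    assert (0 < (IZR m - 1) * e) by (apply Rmult_lt_0_compat; lra).
    apply (Rmult_eq_reg_l ((IZR m - 1) * e)); lra. }
  assert (Z2 : forall m, (2 <= m)%Z -> forall w, rpair w (f m) = 0).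
  { intros m. apply (Zlt_lower_bound_ind (fun m => forall w, rpair w (f m) = 0) 2).
    clear m. intros m IH Hm.
    destruct (Z.eq_dec m 2) as [->|N]; [exact H2|].
    replace m with (m - 1 + 1)%Z by lia. apply S; [lia|]. apply IH; lia. }
  destruct (Z.eq_dec n 1) as [->|N]; [exact H1|]. apply Z2; lia.
Qed.

(** * Moments of a cocycle against periodic weights *)

Definition periodic {K : Type} (e : R) (kap : K * R -> R) : Prop :=
  forall k x, kap (k, x + e) = kap (k, x).

Lemma periodic_mult {K : Type} e (kap : K * R -> R) m :
  periodic e kap -> m = -1 \/ m = 1 \/ m = 2 ->
  forall k x, kap (k, x + m * e) = kap (k, x).
Proof.
  intros H Hm k x. destruct Hm as [->|[->| ->]].
  - rewrite <- (H k (x + -1 * e)). f_equal. f_equal. ring.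
  - now rewrite Rmult_1_l.
  - replace (x + 2 * e) with (x + e + e) by ring. now rewrite !H.
Qed.

Lemma periodic_scal {K : Type} e (th : K -> R) (kap : K * R -> R) :
  periodic e kap -> periodic e (fun t => th (fst t) * kap t).
Proof. intros H k x; simpl. now rewrite H. Qed.

(** A periodic weight does not see translation by multiples of e, so the position cancels between
    the two terms of [wittT] and a scalar depending only on k is left. *)
Lemma moment0_cocycle {K : Type} (al : K -> R) e f kap m n :
  0 < e -> witt_cocycle al e f -> periodic e kap ->
  IZR m = -1 \/ IZR m = 1 \/ IZR m = 2 -> IZR n = -1 \/ IZR n = 1 \/ IZR n = 2 ->
  (IZR m - IZR n) * rpair kap (f (m + n)%Z)
  = rpair (fun t => (2 * al (fst t) * IZR m - IZR n) * kap t) (f n)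
    - rpair (fun t => (2 * al (fst t) * IZR n - IZR m) * kap t) (f m).
Proof.
  intros He Hc Hk Hm Hn. apply (Rmult_eq_reg_l e); [|lra].
  transitivity ((IZR m - IZR n) * e * rpair kap (f (m + n)%Z)); [ring|].
  rewrite Hc, Rmult_minus_distr_l, <- !rpair_scal. f_equal; apply rpair_ext; intros [k x];
    unfold wittT; simpl; rewrite (periodic_mult e kap _ Hk) by assumption; ring.
Qed.

(** The terms quadratic in the position cancel, so the moments of order at most 1 form a closed
    system. *)
Lemma moment1_cocycle {K : Type} (al : K -> R) e f kap m n :
  0 < e -> witt_cocycle al e f -> periodic e kap ->
  IZR m = -1 \/ IZR m = 1 \/ IZR m = 2 -> IZR n = -1 \/ IZR n = 1 \/ IZR n = 2 ->
  (IZR m - IZR n) * rpair (fun t => snd t * kap t) (f (m + n)%Z)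
  = rpair (fun t => (al (fst t) * IZR m * IZR m * e
             + ((2 * al (fst t) - 1) * IZR m - IZR n) * snd t) * kap t) (f n)
    - rpair (fun t => (al (fst t) * IZR n * IZR n * e
             + ((2 * al (fst t) - 1) * IZR n - IZR m) * snd t) * kap t) (f m).
Proof.
  intros He Hc Hk Hm Hn. apply (Rmult_eq_reg_l e); [|lra].
  transitivity ((IZR m - IZR n) * e * rpair (fun t => snd t * kap t) (f (m + n)%Z)); [ring|].
  rewrite Hc, Rmult_minus_distr_l, <- !rpair_scal. f_equal; apply rpair_ext; intros [k x];
    unfold wittT; simpl; rewrite (periodic_mult e kap _ Hk) by assumption; ring.
Qed.

(** At (e, -e) both scalars are 2a + 1 up to sign. They depend on k, so they are divided out inside
    the weight, which remains periodic; the next three lemmas do the same with their own scalars. *)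
Lemma moment0_neg {K : Type} (al : K -> R) e f kap :
  0 < e -> (forall k, 1 / 2 <= al k) -> witt_cocycle al e f ->
  (forall w, rpair w (f 0%Z) = 0) -> periodic e kap ->
  rpair kap (f (-1)%Z) = - rpair kap (f 1%Z).
Proof.
  intros He Hal Hc H0 Hk.
  generalize (moment0_cocycle al e f _ 1 (-1) He Hc
    (periodic_scal e (fun k => / (2 * al k + 1)) kap Hk)
    (or_intror (or_introl eq_refl)) (or_introl eq_refl)).
  simpl (1 + -1)%Z. rewrite H0.
  rewrite (rpair_ext _ kap (f (-1)%Z)), (rpair_ext _ (fun t => -1 * kap t) (f 1%Z)), rpair_scal.
  - lra.
  - intros [k x]; simpl. specialize (Hal k). field; lra.
  - intros [k x]; simpl. specialize (Hal k). field; lra.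
Qed.

Lemma moment0_double {K : Type} (al : K -> R) e f kap :
  0 < e -> (forall k, 1 / 2 <= al k) -> witt_cocycle al e f ->
  (forall w, rpair w (f 0%Z) = 0) -> periodic e kap ->
  rpair kap (f 2%Z) = 2 * rpair kap (f 1%Z).
Proof.
  intros He Hal Hc H0 Hk.
  set (k' := fun t => / (2 * al (fst t) + 2) * kap t).
  assert (Hk' : periodic e k') by exact (periodic_scal e (fun k => / (2 * al k + 2)) kap Hk).
  generalize (moment0_cocycle al e f _ 2 (-1) He Hc Hk'
    (or_intror (or_intror eq_refl)) (or_introl eq_refl)).
  simpl (2 + -1)%Z.
  rewrite (moment0_neg al e f (fun t => (2 * al (fst t) * 2 - -1) * k' t) He Hal Hc H0
             (periodic_scal e (fun k => 2 * al k * 2 - -1) k' Hk')).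
  rewrite (rpair_ext _ (fun t => -1 * kap t) (f 2%Z)), rpair_scal.
  - intros E.
    assert (E' : rpair kap (f 1%Z)
      = / 2 * rpair (fun t => (2 * al (fst t) * 2 - -1) * k' t) (f 1%Z)
        + 3 / 2 * rpair k' (f 1%Z)); [|lra].
    rewrite <- rpair_lin. apply rpair_ext. intros [k x]; unfold k'; simpl.
    specialize (Hal k). field; lra.
  - intros [k x]; unfold k'; simpl. specialize (Hal k). field; lra.
Qed.

Lemma moment1_neg {K : Type} (al : K -> R) e f kap :
  0 < e -> (forall k, 1 / 2 <= al k) -> witt_cocycle al e f ->
  (forall w, rpair w (f 0%Z) = 0) -> periodic e kap ->
  rpair (fun t => snd t * kap t) (f (-1)%Z)
  = e * rpair kap (f 1%Z) - rpair (fun t => snd t * kap t) (f 1%Z).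
Proof.
  intros He Hal Hc H0 Hk.
  set (k' := fun t => / (2 * al (fst t)) * kap t).
  assert (Hk' : periodic e k') by exact (periodic_scal e (fun k => / (2 * al k)) kap Hk).
  generalize (moment1_cocycle al e f _ 1 (-1) He Hc Hk'
    (or_intror (or_introl eq_refl)) (or_introl eq_refl)).
  simpl (1 + -1)%Z. rewrite H0.
  rewrite (rpair_ext _ (fun t => e / 2 * kap t + 1 * (snd t * kap t)) (f (-1)%Z)), rpair_lin.
  rewrite (rpair_ext _ (fun t => e / 2 * kap t + -1 * (snd t * kap t)) (f 1%Z)), rpair_lin.
  - rewrite (moment0_neg al e f kap He Hal Hc H0 Hk). lra.
  - intros [k x]; unfold k'; simpl. specialize (Hal k). field; lra.
  - intros [k x]; unfold k'; simpl. specialize (Hal k). field; lra.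
Qed.

(** The right-hand side is the first moment of (1 + u) f_1, so f_2 - (1 + u) f_1 has first moment
    0. *)
Lemma moment1_double {K : Type} (al : K -> R) e f kap :
  0 < e -> (forall k, 1 / 2 <= al k) -> witt_cocycle al e f ->
  (forall w, rpair w (f 0%Z) = 0) -> periodic e kap ->
  rpair (fun t => snd t * kap t) (f 2%Z)
  = 2 * rpair (fun t => snd t * kap t) (f 1%Z) + e * rpair kap (f 1%Z).
Proof.
  intros He Hal Hc H0 Hk.
  set (k' := fun t => / (2 * al (fst t) + 1) * kap t).
  assert (Hk' : periodic e k') by exact (periodic_scal e (fun k => / (2 * al k + 1)) kap Hk).
  generalize (moment1_cocycle al e f _ 2 (-1) He Hc Hk'
    (or_intror (or_intror eq_refl)) (or_introl eq_refl)).
  simpl (2 + -1)%Z.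
  (* At (2e, -e), L_2e turns x k' into 4ae k' + (4a - 1) x k', that is, e ka + x kb. *)
  set (ka := fun t => 4 * al (fst t) * k' t).
  set (kb := fun t => (4 * al (fst t) - 1) * k' t).
  assert (Ha : periodic e ka) by exact (periodic_scal e (fun k => 4 * al k) k' Hk').
  assert (Hb : periodic e kb) by exact (periodic_scal e (fun k => 4 * al k - 1) k' Hk').
  rewrite (rpair_ext _ (fun t => e * ka t + 1 * (snd t * kb t)) (f (-1)%Z)), rpair_lin
    by (intros [k x]; unfold ka, kb; simpl; ring).
  rewrite (rpair_ext _ (fun t => e / 4 * ka t + -1 * (snd t * kap t)) (f 2%Z)), rpair_lin.
  - rewrite (moment0_neg al e f ka), (moment1_neg al e f kb), (moment0_double al e f ka)
      by assumption.
    intros E.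
    assert (E1 : rpair kap (f 1%Z) = / 2 * rpair ka (f 1%Z) + 1 * rpair k' (f 1%Z)).
    { rewrite <- rpair_lin. apply rpair_ext. intros [k x]; unfold ka, k'; simpl.
      specialize (Hal k). field; lra. }
    assert (E2 : rpair kb (f 1%Z) = 1 * rpair ka (f 1%Z) + -1 * rpair k' (f 1%Z)).
    { rewrite <- rpair_lin. apply rpair_ext. intros [k x]; unfold ka, kb, k'; simpl. ring. }
    assert (E3 : 2 * rpair (fun t => snd t * kap t) (f 1%Z)
      = 3 * rpair (fun t => snd t * k' t) (f 1%Z) + 1 * rpair (fun t => snd t * kb t) (f 1%Z)).
    { rewrite <- rpair_lin, <- rpair_scal. apply rpair_ext. intros [k x]; unfold kb, k'; simpl.
      specialize (Hal k). field; lra. }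
    rewrite E1. rewrite E2 in E. nra.
  - intros [k x]; unfold ka, k'; simpl. specialize (Hal k). field; lra.
Qed.

Lemma witt_positive_coboundary {K : Type} (al : K -> R) e f :
  0 < e -> (forall k, 1 / 2 <= al k) -> witt_cocycle al e f ->
  (forall w, rpair w (f 0%Z) = 0) ->
  exists g, forall n, (1 <= n)%Z -> forall w,
    rpair w (f n) = rpair (wittT al (IZR n * e) 0 w) g.
Proof.
  intros He Hal Hc H0.
  (* h is f_2 - (1 + u) f_1; its division by (1 - u)^2 and then by a e yields g. *)
  set (h := f 2%Z ++ rscale (-1) (f 1%Z)
            ++ map (fun t => (-1 * fst t, (fst (snd t), snd (snd t) + e))) (f 1%Z)).
  assert (Hh : forall w, rpair w h = rpair w (f 2%Z)
            - rpair (fun t => w t + w (fst t, snd t + e)) (f 1%Z)).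
  { intros w. unfold h. rewrite !rpair_app, rpair_rscale.
    rewrite (rpair_map (fun _ => -1) (fun t => (fst t, snd t + e))), rpair_scal.
    rewrite (rpair_ext (fun t => w t + w (fst t, snd t + e))
      (fun t => 1 * w t + 1 * w (fst t, snd t + e))), rpair_lin; [ring|].
    intros; ring. }
  destruct (divide_of_moments e h He) as [G HG].
  { intros kap Hk. rewrite !Hh.
    rewrite (rpair_ext (fun t => kap t + _) (fun t => 2 * kap t)), rpair_scal
      by (intros [k x]; simpl; rewrite Hk; ring).
    rewrite (rpair_ext (fun t => snd t * kap t + _)
      (fun t => 2 * (snd t * kap t) + e * kap t)), rpair_lin
      by (intros [k x]; simpl; rewrite Hk; ring).
    rewrite (moment0_double al e f kap), (moment1_double al e f kap) by assumption.
    split; ring. }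
  set (g := map (fun t => (/ (al (fst (snd t)) * e) * fst t, snd t)) G).
  assert (Hg : forall w, rpair w g = rpair (fun t => / (al (fst t) * e) * w t) G).
  { intros w. exact (rpair_map (fun t => / (al (fst t) * e)) (fun t => t) w G). }
  exists g.
  set (f' := fun n => f n ++ rscale (-1) (witt_act al (IZR n * e) 0 g)).
  assert (Hf' : forall n w, rpair w (f' n) = rpair w (f n) - rpair (wittT al (IZR n * e) 0 w) g).
  { intros n w. unfold f'. rewrite rpair_app, rpair_rscale, rpair_witt_act. ring. }
  assert (Hc' : witt_cocycle al e f').
  { intros m n w. rewrite !Hf', plus_IZR.
    rewrite !Rmult_minus_distr_l, Hc, Rmult_plus_distr_r.
    rewrite (Rmult_minus_distr_r e), <- rpair_scal.
    rewrite (rpair_ext _ _ g (wittT_bracket al (IZR m * e) (IZR n * e) w)).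
    rewrite (rpair_ext (fun t => _ - _) (fun t =>
      1 * wittT al (IZR n * e) 0 (wittT al (IZR m * e) (IZR n * e) w) t
      + -1 * wittT al (IZR m * e) 0 (wittT al (IZR n * e) (IZR m * e) w) t)), rpair_lin
      by (intros; ring).
    ring. }
  assert (H2' : forall w, rpair w (f' 2%Z)
                = rpair (fun t => w t + w (fst t, snd t + e)) (f' 1%Z)).
  { intros w. rewrite !Hf'. specialize (Hh w). rewrite HG in Hh.
    enough (E : rpair (fun t => second_diff e (fun x => w (fst t, x)) (snd t)) G
      = rpair (wittT al (2 * e) 0 w) g
        - rpair (wittT al (1 * e) 0 (fun t => w t + w (fst t, snd t + e))) g) by lra.
    rewrite !Hg.
    transitivity (1 * rpair (fun t => / (al (fst t) * e) * wittT al (2 * e) 0 w t) G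
      + -1 * rpair (fun t => / (al (fst t) * e) *
              wittT al (1 * e) 0 (fun t => w t + w (fst t, snd t + e)) t) G); [|ring].
    rewrite <- rpair_lin. apply rpair_ext. intros [k x].
    unfold wittT, second_diff; simpl. specialize (Hal k). rewrite !Rmult_1_l.
    replace (x + 2 * e) with (x + e + e) by ring. field; lra. }
  assert (H1' := cocycle_bottom al e f' He Hal Hc' H2').
  intros n Hn w.
  enough (rpair w (f' n) = 0) by (rewrite Hf' in *; lra).
  apply (cocycle_vanish al e f' He Hc' H1'); [|assumption].
  intros w'. rewrite H2'. apply H1'.
Qed.

(** * Real cocycles on the superalgebra *)

Definition sg (b : bool) : R := if b then -1 else 1.

(** The density weight a: L_p sends the element at position x to (a p - x) times the one at p +
    x. *)
Definition wt (k : kind) : R := match k with KL | KI => 1 | KG | KH => 1 / 2 end.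

Definition bw (x a : basis) (w : basis -> R) : R := fst (br x a) * w (snd (br x a)).

Definition adjT (x : basis) (w : B2 -> R) : B2 -> R := fun t =>
  bw x (fst t) (fun e => w (e, snd t))
  + sg (par x && par (fst t)) * bw x (snd t) (fun e => w (fst t, e)).

Lemma bw_ext x a w w' : (forall e, w e = w' e) -> bw x a w = bw x a w'.
Proof. intros H. unfold bw. now rewrite H. Qed.

(** The bracket adds parities. A vanishing bracket returns the default (KL, 0), possibly of the
    wrong parity, but with coefficient 0. *)
Lemma bw_par x a (F : bool -> basis -> R) :
  bw x a (fun e => F (par e) e) = bw x a (F (xorb (par x) (par a))).
Proof.
  unfold bw. destruct x as [[] p], a as [[] q]; unfold par; simpl; ring.
Qed.

Lemma bw_antisym x y w : bw y x w = - sg (par x && par y) * bw x y w.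
Proof.
  unfold bw, sg. destruct x as [[] p], y as [[] q]; unfold par; simpl; try ring;
    rewrite ?(Rplus_comm q p); ring.
Qed.

Lemma bw_jacobi x y a w :
  fst (br x y) * bw (snd (br x y)) a w
  = bw y a (fun e => bw x e w) - sg (par x && par y) * bw x a (fun e => bw y e w).
Proof.
  unfold bw, sg. destruct x as [[] p], y as [[] q], a as [[] r]; unfold par; simpl;
    repeat match goal with
    | |- context [w (?k, ?z)] =>
        lazymatch z with
        | p + q + r => fail
        | _ => replace z with (p + q + r) by ring
        end
    end; field.
Qed.

Lemma adjT_adjT x y w a b :
  adjT y (adjT x w) (a, b)
  = bw y a (fun e => bw x e (fun e' => w (e', b)))
    + sg (par x && xorb (par y) (par a)) * bw y a (fun e => bw x b (fun e' => w (e, e')))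
    + sg (par y && par a) * (bw y b (fun e => bw x a (fun e' => w (e', e)))
      + sg (par x && par a) * bw y b (fun e => bw x e (fun e' => w (a, e')))).
Proof.
  unfold adjT; simpl.
  rewrite (bw_par y a (fun v e => bw x e (fun e0 => w (e0, b))
     + sg (par x && v) * bw x b (fun e0 => w (e, e0)))).
  unfold bw; ring.
Qed.

Lemma adjT_bracket x y w t :
  fst (br x y) * adjT (snd (br x y)) w t
  = adjT y (adjT x w) t - sg (par x && par y) * adjT x (adjT y w) t.
Proof.
  destruct t as [a b]. rewrite !adjT_adjT.
  transitivity (fst (br x y) * bw (snd (br x y)) a (fun e => w (e, b))
    + sg (xorb (par x) (par y) && par a)
      * (fst (br x y) * bw (snd (br x y)) b (fun e => w (a, e)))).
  - unfold adjT; simpl.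
    assert (E := bw_par x y (fun v z => sg (v && par a) * bw z b (fun e => w (a, e)))).
    unfold bw at 1 3 in E. simpl in E. rewrite Rmult_plus_distr_l, E. ring.
  - rewrite !bw_jacobi.
    (* In the mixed terms x and y act on different factors; these actions commute, and the signs
       make the terms cancel. *)
    assert (S : forall c d, bw c a (fun e => bw d b (fun e0 => w (e, e0)))
                          = bw d b (fun e => bw c a (fun e0 => w (e0, e)))).
    { intros; unfold bw; ring. }
    rewrite !S.
    destruct (par x), (par y), (par a); simpl; ring.
Qed.

Lemma adjT_L p X x Y y w :
  adjT (KL, p) w ((X, x), (Y, y))
  = (wt X * p - x) * w ((X, p + x), (Y, y)) + (wt Y * p - y) * w ((X, x), (Y, p + y)).
Proof. unfold adjT, bw, wt, sg, par; destruct X, Y; simpl; rewrite Rmult_1_l; f_equal; f_equal; field. Qed.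

Lemma wt_ge k : 1 / 2 <= wt k.
Proof. destruct k; simpl; lra. Qed.

(** Says that all total coefficients outside P vanish; cancelling entries outside P are allowed. *)
Definition supp {T : Type} (P : T -> Prop) (l : list (R * T)) : Prop :=
  forall w, (forall t, P t -> w t = 0) -> rpair w l = 0.

Lemma supp_ext {T : Type} (P : T -> Prop) l w w' :
  supp P l -> (forall t, P t -> w t = w' t) -> rpair w l = rpair w' l.
Proof.
  intros HP H.
  assert (E : rpair (fun t => 1 * w t + -1 * w' t) l = 0).
  { apply HP. intros t Ht. rewrite (H t Ht). ring. }
  rewrite rpair_lin in E. lra.
Qed.

Definition adjl (x : basis) (l : list (R * B2)) : list (R * B2) :=
  map (fun e => (fst (br x (fst (snd e))) * fst e, (snd (br x (fst (snd e))), snd (snd e)))) l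
  ++ map (fun e => (sg (par x && par (fst (snd e))) * fst (br x (snd (snd e))) * fst e,
                    (fst (snd e), snd (br x (snd (snd e)))))) l.

Lemma rpair_adjl x w l : rpair w (adjl x l) = rpair (adjT x w) l.
Proof.
  unfold adjl. rewrite rpair_app.
  rewrite (@rpair_map B2 B2 (fun t => fst (br x (fst t))) (fun t => (snd (br x (fst t)), snd t))).
  rewrite (@rpair_map B2 B2 (fun t => sg (par x && par (fst t)) * fst (br x (snd t)))
    (fun t => (fst t, snd (br x (snd t))))).
  rewrite <- (Rmult_1_l (rpair _ l)), <- (Rmult_1_l (rpair (fun t => _ * _ * _) l)).
  rewrite <- rpair_lin. apply rpair_ext. intros t. unfold adjT, bw. ring.
Qed.

Definition real_cocycle (Gam : R -> Prop) (s : R) (D : basis -> list (R * B2)) : Prop :=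
  forall x y, valid Gam s x -> valid Gam s y -> forall w,
    fst (br x y) * rpair w (D (snd (br x y)))
    = rpair (adjT x w) (D y) - sg (par x && par y) * rpair (adjT y w) (D x).

Definition sub_inner (D : basis -> list (R * B2)) (r : list (R * B2)) : basis -> list (R * B2) :=
  fun x => D x ++ rscale (-1) (adjl x r).

Lemma rpair_sub_inner D r x w :
  rpair w (sub_inner D r x) = rpair w (D x) - rpair (adjT x w) r.
Proof. unfold sub_inner. rewrite rpair_app, rpair_rscale, rpair_adjl. ring. Qed.

Lemma cocycle_sub_inner Gam s D r :
  real_cocycle Gam s D -> real_cocycle Gam s (sub_inner D r).
Proof.
  intros Hc x y Hx Hy w. rewrite !rpair_sub_inner.
  rewrite Rmult_minus_distr_l, Hc by assumption.
  rewrite <- (rpair_scal (fst (br x y)) (adjT (snd (br x y)) w) r).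
  rewrite (rpair_ext (fun t => fst (br x y) * _) (fun t => 1 * adjT y (adjT x w) t
    + - sg (par x && par y) * adjT x (adjT y w) t)),
    (rpair_lin 1 (- sg (par x && par y)) (adjT y (adjT x w)) (adjT x (adjT y w))).
  - ring.
  - intros t. rewrite adjT_bracket. ring.
Qed.

Lemma dirac_pair_neq (a b a' b' : basis) :
  snd a <> snd a' \/ snd b <> snd b' -> dirac (a, b) (a', b') = 0.
Proof. intros H. apply dirac_neq. intros E. inversion E; subst. tauto. Qed.

(** * Vanishing of invariant and equivariant tensors *)

Lemma invariant_zero (e : R) (l : list (R * B2)) :
  0 < e -> (forall n, (1 <= n)%Z -> forall w, rpair (adjT (KL, IZR n * e) w) l = 0) ->
  forall w, rpair w l = 0.
Proof.
  intros He H. apply rpair_null. intros [[X x] [Y y]].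
  (* With p this large, no entry of l has first position x + p. The coefficient of L_p l at (x + p,
     y) then comes only from (x, y), with the factor a p - x, which is nonzero. *)
  destruct (exists_multiple_above e (x / wt X :: map (fun c => snd (fst (snd c)) - x) l) He)
    as (n & Hn & Hbig).
  set (p := IZR n * e) in *.
  assert (Hx : wt X * p - x <> 0).
  { assert (x / wt X < p) by (apply Hbig; now left). assert (A := wt_ge X).
    assert (x = x / wt X * wt X) by (field; lra). nra. }
  apply (Rmult_eq_reg_l (wt X * p - x)); [|assumption].
  rewrite Rmult_0_r, <- rpair_scal, <- (H n Hn (dirac ((X, p + x), (Y, y)))).
  apply rpair_ext_in. intros c [[X' x'] [Y' y']] Hin. fold p. rewrite adjT_L.
  assert (Hl : x' - x < p).
  { apply Hbig; right. now apply (in_map (fun c => snd (fst (snd c)) - x)) in Hin. }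
  rewrite (dirac_pair_neq (X, p + x) _ (X', x')) by (simpl; left; intro; lra).
  destruct (classic (((X, x), (Y, y)) = ((X', x'), (Y', y')))) as [E|N].
  - inversion E; subst. rewrite !dirac_same. ring.
  - rewrite !dirac_neq; [ring| |assumption]. intros E; apply N. inversion E.
    assert (x = x') by lra. now subst.
Qed.

(* For p, q large and independent, the coefficient at (x+p, y+q) of L_p L_q F_r is a
   nonzero multiple of F_r(x,y), while L_(p+q) F_r, hence F_(p+q+r), vanishes there. *)
Lemma equivariant_zero (e c : R) (F : R -> list (R * B2)) (Q : R -> Prop) :
  0 < e -> 0 < c ->
  (forall n r, (1 <= n)%Z -> Q r -> Q (IZR n * e + r)) ->
  (forall n r, (1 <= n)%Z -> Q r -> forall w,
     (c * (IZR n * e) - r) * rpair w (F (IZR n * e + r))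
     = rpair (adjT (KL, IZR n * e) w) (F r)) ->
  forall r, Q r -> forall w, rpair w (F r) = 0.
Proof.
  intros He Hc0 HQ HF r Hr. apply rpair_null. intros [[X x] [Y y]].
  destruct (exists_multiple_above e (x / wt X :: map (fun c => snd (fst (snd c)) - x) (F r)) He)
    as (n & Hn & Hp).
  set (p := IZR n * e) in *.
  destruct (exists_multiple_above e (y / wt Y :: r / c - p ::
      map (fun c => x - snd (fst (snd c))) (F r)
      ++ map (fun c => x + p - snd (fst (snd c))) (F r)) He)
    as (m & Hm & Hq).
  set (q := IZR m * e) in *.
  assert (Hx : wt X * p - x <> 0).
  { assert (x / wt X < p) by (apply Hp; now left). assert (A := wt_ge X).
    assert (x = x / wt X * wt X) by (field; lra). nra. }
  assert (Hy : wt Y * q - y <> 0).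
  { assert (y / wt Y < q) by (apply Hq; now left). assert (A := wt_ge Y).
    assert (y = y / wt Y * wt Y) by (field; lra). nra. }
  assert (Hpq : c * (p + q) - r <> 0).
  { assert (r / c - p < q) by (apply Hq; right; now left).
    assert (r = r / c * c) by (field; lra). nra. }
  set (W := @dirac B2 ((X, x + p), (Y, y + q))).
  assert (Hs : forall c X' x' Y' y', In (c, ((X', x'), (Y', y'))) (F r) ->
     x' - x < p /\ x - x' < q /\ x + p - x' < q).
  { intros d X' x' Y' y' Hin. repeat split.
    - apply Hp; right. now apply (in_map (fun c => snd (fst (snd c)) - x)) in Hin.
    - apply Hq; right; right; apply in_or_app; left.
      now apply (in_map (fun c => x - snd (fst (snd c)))) in Hin.
    - apply Hq; right; right; apply in_or_app; right.
      now apply (in_map (fun c => x + p - snd (fst (snd c)))) in Hin. }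
  assert (E0 : rpair W (F (p + (q + r))) = 0).
  { apply (Rmult_eq_reg_l (c * (p + q) - r)); [|assumption].
    generalize (HF (n + m)%Z r ltac:(lia) Hr W).
    rewrite plus_IZR, Rmult_plus_distr_r. fold p q.
    replace (p + q + r) with (p + (q + r)) by ring.
    intros ->. rewrite Rmult_0_r. apply rpair_zero.
    intros d [[X' x'] [Y' y']] Hin. rewrite adjT_L. unfold W.
    destruct (Hs _ _ _ _ _ Hin) as (? & ? & ?).
    rewrite !dirac_pair_neq by (simpl; left; intro; lra). ring. }
  apply (Rmult_eq_reg_l ((wt Y * q - y) * (wt X * p - x)));
    [|now apply Rmult_integral_contrapositive].
  rewrite Rmult_0_r, <- rpair_scal.
  transitivity (rpair (adjT (KL, q) (adjT (KL, p) W)) (F r)).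
  - apply rpair_ext_in. intros d [[X' x'] [Y' y']] Hin.
    destruct (Hs _ _ _ _ _ Hin) as (? & ? & ?).
    rewrite !adjT_L. unfold W.
    rewrite (dirac_pair_neq (X, x + p) _ (X', p + (q + x'))) by (simpl; left; intro; lra).
    rewrite (dirac_pair_neq (X, x + p) _ (X', q + x')) by (simpl; left; intro; lra).
    rewrite (dirac_pair_neq (X, x + p) _ (X', x')) by (simpl; left; intro; lra).
    destruct (classic (((X, x), (Y, y)) = ((X', x'), (Y', y')))) as [E|N].
    + inversion E; subst. rewrite (Rplus_comm p x'), (Rplus_comm q y'), !dirac_same. ring.
    + rewrite !dirac_neq; [ring| |assumption]. intros E; apply N. inversion E.
      assert (x = x') by lra. assert (y = y') by lra. now subst.
  - unfold q. rewrite <- HF by assumption. fold q.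
    assert (Hqr : Q (q + r)) by (apply HQ; assumption).
    unfold p. rewrite <- (HF n (q + r)) by assumption. fold p. rewrite E0. ring.
Qed.

(** * Real cocycles are inner *)

Record subgroup (Gam : R -> Prop) : Prop := {
  sub0 : Gam 0;
  subD : forall x y, Gam x -> Gam y -> Gam (x + y);
  subN : forall x, Gam x -> Gam (- x) }.

Lemma subgroup_mult Gam e n : subgroup Gam -> Gam e -> Gam (IZR n * e).
Proof.
  intros HG He. induction n as [|n IH|n IH] using Z.peano_ind.
  - rewrite Rmult_0_l. apply (sub0 _ HG).
  - rewrite succ_IZR, Rmult_plus_distr_r, Rmult_1_l. now apply (subD _ HG).
  - rewrite <- Z.sub_1_r, minus_IZR, Rmult_minus_distr_r, Rmult_1_l.
    apply (subD _ HG); [|apply (subN _ HG)]; assumption.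
Qed.

Definition deg (t : B2) : R := snd (fst t) + snd (snd t).
Definition even2 (t : B2) : Prop := par (fst t) = par (snd t).

Lemma even2_wt k x k' y : even2 ((k, x), (k', y)) -> wt k = wt k'.
Proof. unfold even2, par; destruct k, k'; simpl; congruence. Qed.

Lemma adjT_even p w t : (forall t, even2 t -> w t = 0) -> even2 t -> adjT (KL, p) w t = 0.
Proof.
  intros Hw Ht. destruct t as [[X x] [Y y]]. rewrite adjT_L, !Hw; [ring|exact Ht|exact Ht].
Qed.

Lemma adjT_deg p d w t : (forall t, deg t = d -> w t = 0) -> deg t = d - p ->
  adjT (KL, p) w t = 0.
Proof.
  intros Hw Ht. destruct t as [[X x] [Y y]]. unfold deg in *; simpl in *.
  rewrite adjT_L, !Hw; simpl; [ring|lra|lra].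
Qed.

Lemma adjT_L0 w t : adjT (KL, 0) w t = - deg t * w t.
Proof.
  destruct t as [[X x] [Y y]]. rewrite adjT_L, !Rplus_0_l. unfold deg, basis; simpl. ring.
Qed.

Lemma cocycle_LL Gam s D p q w :
  real_cocycle Gam s D -> Gam p -> Gam q ->
  (p - q) * rpair w (D (KL, p + q))
  = rpair (adjT (KL, p) w) (D (KL, q)) - rpair (adjT (KL, q) w) (D (KL, p)).
Proof.
  intros Hc Hp Hq. generalize (Hc (KL, p) (KL, q) Hp Hq w); unfold par; simpl.
  intros ->. ring.
Qed.

Lemma homogeneous_reduction Gam s D :
  subgroup Gam -> real_cocycle Gam s D ->
  (forall p, Gam p -> supp even2 (D (KL, p))) ->
  exists r, forall p, Gam p ->
    supp even2 (sub_inner D r (KL, p)) /\ supp (fun t => deg t = p) (sub_inner D r (KL, p)).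
Proof.
  intros HG Hc Hev.
  assert (G0 := sub0 _ HG).
  (* L_0 acts as -deg, so m inverts it off degree 0, and the corrected D(L_0) has only degree 0
     left. *)
  set (m := fun t : B2 => if Req_EM_T (deg t) 0 then 0 else - / deg t).
  set (r := map (fun e => (m (snd e) * fst e, snd e)) (D (KL, 0))).
  assert (Hr : forall w, rpair w r = rpair (fun t => m t * w t) (D (KL, 0)))
    by (intros w; exact (rpair_map m (fun t => t) w (D (KL, 0)))).
  exists r. intros p Hp. split.
  - intros w Hw. rewrite rpair_sub_inner, Hr, (Hev p Hp w Hw), (Hev 0 G0); [ring|].
    intros t Ht. rewrite adjT_even by assumption. ring.
  - assert (Hc' := cocycle_sub_inner Gam s D r Hc).
    assert (H0 : supp (fun t => deg t = 0) (sub_inner D r (KL, 0))).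
    { intros w Hw. rewrite rpair_sub_inner, Hr.
      rewrite (rpair_ext (fun t => m t * _) w); [ring|].
      intros t. rewrite adjT_L0. unfold m.
      destruct (Req_EM_T (deg t) 0) as [E|N]; [rewrite Hw by assumption; ring|field; assumption]. }
    intros w Hw.
    (* By the cocycle identity at (0, p), (deg - p) D(L_p) = - L_p D(L_0), which lives in degree p;
       w' divides by deg - p elsewhere. *)
    set (w' := fun t => (if Req_EM_T (deg t - p) 0 then 0 else / (deg t - p)) * w t).
    generalize (cocycle_LL Gam s _ 0 p w' Hc' G0 Hp). rewrite Rplus_0_l.
    rewrite (H0 (adjT (KL, p) w')).
    2:{ intros t Ht. apply (adjT_deg p p); [|lra]. intros t' Ht'. unfold w'.
        rewrite Hw by assumption. ring. }
    intros E.
    assert (E' : rpair (fun t => p * w' t + 1 * adjT (KL, 0) w' t) (sub_inner D r (KL, p)) = 0).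
    { rewrite (rpair_lin p 1 w' (adjT (KL, 0) w')). lra. }
    rewrite (rpair_ext _ (fun t => -1 * w t)), rpair_scal in E'; [lra|].
    intros t. rewrite adjT_L0. unfold w'. destruct (Req_EM_T (deg t - p) 0) as [E1|N].
    + rewrite (Hw t) by lra. ring.
    + field; lra.
Qed.

(** In a fixed total degree the second position is determined by the first, so nothing is lost. *)
Definition forget2 (t : B2) : (kind * kind) * R :=
  ((fst (fst t), fst (snd t)), snd (fst t)).

Lemma wittT_forget2 p q w t :
  even2 t -> deg t = q ->
  adjT (KL, p) (fun t => w (forget2 t)) t
  = wittT (fun k : kind * kind => wt (fst k)) p q w (forget2 t).
Proof.
  intros He Hd. destruct t as [[X x] [Y y]]. rewrite adjT_L. unfold wittT, forget2; simpl.
  rewrite <- (even2_wt _ _ _ _ He). unfold deg in Hd; simpl in Hd. subst q.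
  rewrite (Rplus_comm p x). ring.
Qed.

Lemma inner_on_multiples Gam s D e :
  subgroup Gam -> real_cocycle Gam s D -> Gam e -> 0 < e ->
  (forall p, Gam p -> supp even2 (D (KL, p)) /\ supp (fun t => deg t = p) (D (KL, p))) ->
  exists r, forall n, (1 <= n)%Z -> forall w,
    rpair w (D (KL, IZR n * e)) = rpair (adjT (KL, IZR n * e) w) r.
Proof.
  intros HG Hc Ge He Hs.
  assert (G0 := sub0 _ HG).
  assert (Gn : forall n, Gam (IZR n * e)) by (intros; now apply subgroup_mult).
  assert (Hs' : forall p w w', Gam p -> (forall t, even2 t -> deg t = p -> w t = w' t) ->
    rpair w (D (KL, p)) = rpair w' (D (KL, p))).
  { intros p w w' Hp H. destruct (Hs p Hp) as [S1 S2].
    rewrite (supp_ext _ _ w (fun t => if Req_EM_T (deg t) p then w t else 0) S2).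
    2:{ intros t Ht. destruct (Req_EM_T (deg t) p); tauto. }
    rewrite (supp_ext _ _ w' (fun t => if Req_EM_T (deg t) p then w' t else 0) S2).
    2:{ intros t Ht. destruct (Req_EM_T (deg t) p); tauto. }
    apply (supp_ext _ _ _ _ S1). intros t Ht. destruct (Req_EM_T (deg t) p); auto. }
  (* In the identity at (ne, 0) the term L_0 D(L_ne) = -ne D(L_ne) cancels the left-hand side, so
     every L_ne kills D(L_0). *)
  assert (D0 : forall w, rpair w (D (KL, 0)) = 0).
  { apply (invariant_zero e); [assumption|]. intros n Hn w.
    generalize (cocycle_LL Gam s D _ 0 w Hc (Gn n) G0). rewrite Rplus_0_r.
    rewrite (Hs' _ (adjT (KL, 0) w) (fun t => - (IZR n * e) * w t) (Gn n)), rpair_scal; [lra|].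
    intros t _ Ht. now rewrite adjT_L0, Ht. }
  set (f := fun n => map (fun c => (1 * fst c, forget2 (snd c))) (D (KL, IZR n * e))).
  assert (Hf : forall n w, rpair w (f n) = rpair (fun t => w (forget2 t)) (D (KL, IZR n * e))).
  { intros n w. unfold f. rewrite (rpair_map (fun _ => 1) forget2). apply rpair_ext.
    intros; ring. }
  set (al := fun k : kind * kind => wt (fst k)).
  destruct (witt_positive_coboundary al e f He) as [g Hg].
  - intros k; apply wt_ge.
  - intros m n w. rewrite !Hf, plus_IZR, Rmult_plus_distr_r, Rmult_minus_distr_r.
    rewrite (cocycle_LL Gam s) by auto.
    f_equal; apply Hs'; auto; intros t He1 Hd; now apply wittT_forget2.
  - intros w. rewrite Hf, Rmult_0_l. apply D0.
  (* g may carry pairs of kinds of unequal parity, for which [al] is not the weight of both factors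
     in general. D(L_p) has no such part, so [ev] discards them; the second position -x puts r in
     degree 0. *)
  - set (ev := fun k : kind * kind =>
      if bool_dec (par (fst k, 0)) (par (snd k, 0)) then 1 else 0).
    set (r := map (fun c => (ev (fst (snd c)) * fst c,
      (((fst (fst (snd c)), snd (snd c)), (snd (fst (snd c)), - snd (snd c))) : B2))) g).
    exists r. intros n Hn w. set (p := IZR n * e) in *.
    unfold r. rewrite (@rpair_map _ B2 (fun t => ev (fst t))
      (fun t => ((fst (fst t), snd t), (snd (fst t), - snd t)))).
    rewrite (Hs' p w (fun t => (fun u => ev (fst u) *
       w ((fst (fst u), snd u), (snd (fst u), p - snd u))) (forget2 t)) (Gn n)).
    2:{ intros [[X x] [Y y]] Ht Hd. unfold forget2, deg, ev, even2, par in *; simpl in *.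
        destruct (bool_dec _ _); [|contradiction]. subst p. rewrite <- Hd.
        replace (x + y - x) with y by ring. unfold basis. ring. }
    unfold p at 2. rewrite <- (Hf n (fun u => ev (fst u) *
       w ((fst (fst u), snd u), (snd (fst u), p - snd u)))), Hg by assumption. fold p.
    apply rpair_ext. intros [[X Y] x]. unfold wittT, al; simpl. rewrite adjT_L. unfold basis.
    unfold ev. destruct (bool_dec _ _) as [Ep|Ep]; simpl in *; [|ring].
    rewrite <- (even2_wt X 0 Y 0 Ep).
    replace (p - (x + p)) with (- x) by ring. replace (p + - x) with (p - x) by ring.
    rewrite (Rplus_comm p x). ring.
Qed.

(** Once D kills the L_ne, the cocycle identity says that D commutes with their action, so
    [equivariant_zero] applies to the L and G families, with c the weight of the kind. *)
Lemma cocycle_zero Gam s D e :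
  subgroup Gam -> Gam (2 * s) -> real_cocycle Gam s D -> Gam e -> 0 < e ->
  (forall n, (1 <= n)%Z -> forall w, rpair w (D (KL, IZR n * e)) = 0) ->
  forall x, valid Gam s x -> forall w, rpair w (D x) = 0.
Proof.
  intros HG G2s Hc Ge He H1.
  assert (G0 := sub0 _ HG).
  assert (Gn : forall n, Gam (IZR n * e)) by (intros; now apply subgroup_mult).
  assert (HL : forall p, Gam p -> forall w, rpair w (D (KL, p)) = 0).
  { apply (equivariant_zero e 1 (fun p => D (KL, p)) Gam He); [lra| |].
    - intros n r _ Hr. now apply (subD _ HG).
    - intros n r Hn Hr w. rewrite Rmult_1_l, (cocycle_LL Gam s) by auto.
      rewrite (H1 n Hn). ring. }
  assert (HGG : forall r, Gam (r - s) -> forall w, rpair w (D (KG, r)) = 0).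
  { apply (equivariant_zero e (1 / 2) (fun r => D (KG, r)) (fun r => Gam (r - s)) He); [lra| |].
    - intros n r _ Hr. replace (IZR n * e + r - s) with (IZR n * e + (r - s)) by ring.
      now apply (subD _ HG).
    - intros n r Hn Hr w.
      generalize (Hc (KL, IZR n * e) (KG, r) (Gn n) Hr w). unfold par; simpl. rewrite (H1 n Hn).
      rewrite Rmult_0_r, Rminus_0_r. intros <-. field. }
  assert (HI : forall p, Gam p -> forall w, rpair w (D (KI, p)) = 0).
  { intros p Hp w.
    (* I_p = [G_s, G_(p-s)], and p - s lies in s + Gamma because 2s lies in Gamma. *)
    assert (V1 : Gam (s - s)) by (now rewrite Rminus_diag).
    assert (V2 : Gam (p - s - s)).
    { replace (p - s - s) with (p + - (2 * s)) by ring.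
      apply (subD _ HG); [|apply (subN _ HG)]; assumption. }
    generalize (Hc (KG, s) (KG, p - s) V1 V2 w). simpl.
    replace (s + (p - s)) with p by ring. rewrite !HGG by assumption. lra. }
  intros [[] r] Hx w; try (now auto).
  (* [I_(r-t), G_t] = (r - 3t) H_r; if t = s makes the factor vanish, t = s + e makes it -3e. *)
  assert (Ht : exists t, Gam (t - s) /\ r - t - 2 * t <> 0).
  { destruct (Req_dec (r - s - 2 * s) 0) as [E|N].
    - exists (s + e). split; [replace (s + e - s) with e by ring; assumption|lra].
    - exists s. split; [now rewrite Rminus_diag|assumption]. }
  destruct Ht as (t & Gt & Nt).
  assert (Gp : Gam (r - t)).
  { replace (r - t) with (r - s + - (t - s)) by ring.
    apply (subD _ HG); [|apply (subN _ HG)]; assumption. }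
  generalize (Hc (KI, r - t) (KG, t) Gp Gt w). simpl.
  replace (r - t + t) with r by ring. rewrite HI, HGG by assumption.
  intros E. apply (Rmult_eq_reg_l (r - t - 2 * t)); lra.
Qed.

Theorem real_cocycle_inner Gam s D :
  subgroup Gam -> Gam (2 * s) -> (exists p, Gam p /\ p <> 0) -> real_cocycle Gam s D ->
  (forall p, Gam p -> supp even2 (D (KL, p))) ->
  exists r, forall x, valid Gam s x -> forall w, rpair w (D x) = rpair (adjT x w) r.
Proof.
  intros HG G2s (p & Gp & Np) Hc Hev.
  assert (He : exists e, Gam e /\ 0 < e).
  { destruct (Rlt_le_dec 0 p); [now exists p|].
    exists (- p). split; [now apply (subN _ HG)|lra]. }
  destruct He as (e & Ge & He).
  destruct (homogeneous_reduction Gam s D HG Hc Hev) as [r1 H1].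
  assert (C1 := cocycle_sub_inner Gam s D r1 Hc).
  destruct (inner_on_multiples Gam s _ e HG C1 Ge He H1) as [r2 H2].
  assert (C2 := cocycle_sub_inner Gam s _ r2 C1).
  exists (r1 ++ r2). intros x Hx w.
  rewrite rpair_app.
  enough (E : rpair w (sub_inner (sub_inner D r1) r2 x) = 0)
    by (rewrite !rpair_sub_inner in E; lra).
  apply (cocycle_zero Gam s _ e HG G2s C2 Ge He); [|assumption].
  intros n Hn w'. rewrite rpair_sub_inner, H2 by assumption. ring.
Qed.

(** * Complex formal sums *)

Definition Copp (z : Cx) : Cx := mkCx (- cre z) (- cim z).
Definition Csub (z w : Cx) : Cx := Cadd z (Copp w).

Lemma Cx_eq z w : cre z = cre w -> cim z = cim w -> z = w.
Proof. destruct z, w; simpl; intros -> ->; reflexivity. Qed.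

Lemma Cx_ring : ring_theory C0 C1 Cadd Cmul Csub Copp eq.
Proof. split; intros; apply Cx_eq; simpl; ring. Qed.

Add Ring Cx_ring_inst : Cx_ring.

Definition cpair {T : Type} (w : T -> Cx) (v : vec T) : Cx :=
  fold_right (fun e acc => Cadd (Cmul (fst e) (w (snd e))) acc) C0 v.

Definition rpart {T : Type} (k : Cx -> R) (v : vec T) : list (R * T) :=
  map (fun e => (k (fst e), snd e)) v.

Lemma cpair_cons {T : Type} (w : T -> Cx) c t v :
  cpair w ((c, t) :: v) = Cadd (Cmul c (w t)) (cpair w v).
Proof. reflexivity. Qed.

Lemma cpair_app {T : Type} (w : T -> Cx) v v' :
  cpair w (v ++ v') = Cadd (cpair w v) (cpair w v').
Proof.
  induction v as [|[c t] v IH]; [unfold cpair; simpl; ring|].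
  simpl app. rewrite !cpair_cons, IH. ring.
Qed.

Lemma cpair_ext_in {T : Type} (w w' : T -> Cx) v :
  (forall c t, In (c, t) v -> w t = w' t) -> cpair w v = cpair w' v.
Proof.
  induction v as [|[c t] v IH]; intros H; [reflexivity|].
  rewrite !cpair_cons, IH, (H c t); [reflexivity|now left|].
  intros c' t' Hin; apply (H c'); now right.
Qed.

Lemma cpair_ext {T : Type} (w w' : T -> Cx) v :
  (forall t, w t = w' t) -> cpair w v = cpair w' v.
Proof. intros H; apply cpair_ext_in; auto. Qed.

Lemma cpair_add {T : Type} (w w' : T -> Cx) v :
  cpair (fun t => Cadd (w t) (w' t)) v = Cadd (cpair w v) (cpair w' v).
Proof.
  induction v as [|[c t] v IH]; [unfold cpair; simpl; ring|].
  rewrite !cpair_cons, IH; ring.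
Qed.

Lemma cpair_scal {T : Type} k (w : T -> Cx) v :
  cpair (fun t => Cmul k (w t)) v = Cmul k (cpair w v).
Proof.
  induction v as [|[c t] v IH]; [unfold cpair; simpl; ring|].
  rewrite !cpair_cons, IH; ring.
Qed.

Lemma cpair_flat_map {T U : Type} (h : Cx * T -> vec U) (w : U -> Cx) (w' : T -> Cx) v :
  (forall c t, cpair w (h (c, t)) = Cmul c (w' t)) ->
  cpair w (flat_map h v) = cpair w' v.
Proof.
  intros H. induction v as [|[c t] v IH]; [reflexivity|].
  simpl flat_map. rewrite cpair_app, H, IH. reflexivity.
Qed.

Lemma cpair_map {T U : Type} (h : Cx * T -> Cx * U) (w : U -> Cx) (w' : T -> Cx) v :
  (forall c t, Cmul (fst (h (c, t))) (w (snd (h (c, t)))) = Cmul c (w' t)) ->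
  cpair w (map h v) = cpair w' v.
Proof.
  intros H. induction v as [|[c t] v IH]; [reflexivity|].
  rewrite cpair_cons, <- IH, <- H. reflexivity.
Qed.

Lemma cpair_scale {T : Type} k (w : T -> Cx) v :
  cpair w (scale k v) = Cmul k (cpair w v).
Proof.
  rewrite <- cpair_scal. apply cpair_map. intros c t; simpl. ring.
Qed.

Lemma cpair_vsub {T : Type} (w : T -> Cx) v v' :
  cpair w (vsub v v') = Csub (cpair w v) (cpair w v').
Proof.
  unfold vsub. rewrite cpair_app, cpair_scale.
  apply Cx_eq; simpl; ring.
Qed.

Lemma cpair_swap {T U : Type} (F : T -> U -> Cx) v v' :
  cpair (fun t => cpair (F t) v') v = cpair (fun u => cpair (fun t => F t u) v) v'.
Proof.
  induction v as [|[c t] v IH].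
  - induction v' as [|[c u] v' IH']; [reflexivity|]. rewrite cpair_cons, <- IH'.
    unfold cpair; simpl; ring.
  - rewrite cpair_cons, IH, <- cpair_scal, <- cpair_add. reflexivity.
Qed.

Lemma rpart_cons {T : Type} k c (t : T) v : rpart k ((c, t) :: v) = (k c, t) :: rpart k v.
Proof. reflexivity. Qed.

Lemma cre_cpair {T : Type} (w : T -> Cx) v :
  cre (cpair w v) = rpair (fun t => cre (w t)) (rpart cre v)
                    - rpair (fun t => cim (w t)) (rpart cim v).
Proof.
  induction v as [|[c t] v IH]; [unfold rpair; simpl; ring|].
  rewrite cpair_cons, !rpart_cons, !rpair_cons; simpl. rewrite IH. ring.
Qed.

Lemma cim_cpair {T : Type} (w : T -> Cx) v :
  cim (cpair w v) = rpair (fun t => cre (w t)) (rpart cim v)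
                    + rpair (fun t => cim (w t)) (rpart cre v).
Proof.
  induction v as [|[c t] v IH]; [unfold rpair; simpl; ring|].
  rewrite cpair_cons, !rpart_cons, !rpair_cons; simpl. rewrite IH. ring.
Qed.

Definition component (k : Cx -> R) : Prop := k = cre \/ k = cim.

Lemma rpair_rpart {T : Type} k (w : T -> R) v :
  component k -> rpair w (rpart k v) = k (cpair (fun t => RC (w t)) v).
Proof.
  intros [->| ->]; [rewrite cre_cpair|rewrite cim_cpair];
    change (fun t : T => cre (RC (w t))) with w;
    rewrite (rpair_zero (fun t => cim (RC (w t)))) by reflexivity; ring.
Qed.

Lemma coef_cpair {T : Type} dec (v : vec T) t :
  coef dec v t = cpair (fun t' => RC (dirac t t')) v.
Proof.
  induction v as [|[c u] v IH]; [reflexivity|].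
  rewrite cpair_cons, <- IH. simpl. destruct (dec t u) as [->|N].
  - rewrite dirac_same. change (RC 1) with C1. ring.
  - rewrite dirac_neq by assumption. change (RC 0) with C0. ring.
Qed.

Lemma coef_in {T : Type} dec (v : vec T) t :
  coef dec v t <> C0 -> exists c, In (c, t) v.
Proof.
  induction v as [|[c u] v IH]; simpl; [congruence|].
  destruct (dec t u) as [->|N]; [exists c; now left|].
  intros H; destruct (IH H) as [c' Hc']; exists c'; now right.
Qed.

Lemma rpart_supp {T : Type} dec k (v : vec T) (P : T -> Prop) :
  component k -> (forall t, coef dec v t <> C0 -> P t) -> supp P (rpart k v).
Proof.
  intros Hk H w Hw. apply rpair_supp. intros t.
  destruct (classic (coef dec v t = C0)) as [E|N]; [left|right; auto].
  rewrite rpair_rpart by assumption. rewrite <- (coef_cpair dec), E.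
  destruct Hk as [->| ->]; reflexivity.
Qed.

Lemma cpair_supp {T : Type} dec (v : vec T) (w w' : T -> Cx) :
  (forall t, coef dec v t <> C0 -> w t = w' t) -> cpair w v = cpair w' v.
Proof.
  intros H.
  assert (S : forall k, component k -> forall j : Cx -> R,
    rpair (fun t => j (w t)) (rpart k v) = rpair (fun t => j (w' t)) (rpart k v)).
  { intros k Hk j. apply (supp_ext (fun t => coef dec v t <> C0)).
    - now apply (rpart_supp dec).
    - intros t Ht. now rewrite (H t Ht). }
  apply Cx_eq; rewrite ?cre_cpair, ?cim_cpair, !S; (reflexivity || (now left) || now right).
Qed.

Lemma cpair_equiv {T : Type} dec (v v' : vec T) :
  (forall t, coef dec v t = coef dec v' t) -> forall w, cpair w v = cpair w v'.
Proof.
  intros H w.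
  assert (E : cpair w (vsub v v') = cpair (fun _ => C0) (vsub v v')).
  { apply (cpair_supp dec). intros t Ht. exfalso. apply Ht.
    rewrite coef_cpair, cpair_vsub, <- !(coef_cpair dec), H. ring. }
  rewrite cpair_vsub in E.
  assert (Z : cpair (fun _ : T => C0) (vsub v v') = C0).
  { rewrite (cpair_ext _ (fun _ => Cmul C0 C0)), cpair_scal by (intros; ring). ring. }
  rewrite Z in E. transitivity (Cadd (Csub (cpair w v) (cpair w v')) (cpair w v')); [ring|].
  rewrite E. ring.
Qed.

Lemma equiv_cpair {T : Type} dec (v v' : vec T) :
  (forall w, cpair w v = cpair w v') -> forall t, coef dec v t = coef dec v' t.
Proof. intros H t. now rewrite !coef_cpair. Qed.

Definition cbw (x a : basis) (w : basis -> Cx) : Cx :=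
  Cmul (RC (fst (br x a))) (w (snd (br x a))).

Lemma cre_cbw x a w : cre (cbw x a w) = bw x a (fun e => cre (w e)).
Proof. unfold cbw, bw; simpl; ring. Qed.

Lemma cim_cbw x a w : cim (cbw x a w) = bw x a (fun e => cim (w e)).
Proof. unfold cbw, bw; simpl; ring. Qed.

Lemma sgn_RC b : sgn b = RC (sg b).
Proof. destruct b; reflexivity. Qed.

Lemma cbw_ext x a w w' : (forall e, w e = w' e) -> cbw x a w = cbw x a w'.
Proof. intros H. unfold cbw. now rewrite H. Qed.

Lemma cbw_add x a w w' :
  cbw x a (fun e => Cadd (w e) (w' e)) = Cadd (cbw x a w) (cbw x a w').
Proof. unfold cbw. ring. Qed.

Lemma cbw_scal x a k w : cbw x a (fun e => Cmul k (w e)) = Cmul k (cbw x a w).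
Proof. unfold cbw. ring. Qed.

Lemma cbw_par x a (F : bool -> basis -> Cx) :
  cbw x a (fun e => F (par e) e) = cbw x a (F (xorb (par x) (par a))).
Proof.
  apply Cx_eq; rewrite ?cre_cbw, ?cim_cbw.
  - exact (bw_par x a (fun b e => cre (F b e))).
  - exact (bw_par x a (fun b e => cim (F b e))).
Qed.

Lemma cbw_antisym x y w : cbw y x w = Copp (Cmul (sgn (par x && par y)) (cbw x y w)).
Proof.
  rewrite sgn_RC.
  apply Cx_eq; cbn [cre cim Copp Cmul Cadd RC]; rewrite ?cre_cbw, ?cim_cbw, (bw_antisym x y); ring.
Qed.

Lemma cbw_L_jacobi p b c w :
  cbw b c (fun e => cbw (KL, p) e w)
  = Cadd (cbw (KL, p) b (fun e => cbw e c w)) (cbw (KL, p) c (fun e => cbw b e w)).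
Proof.
  assert (J : forall w : basis -> R, bw b c (fun e => bw (KL, p) e w)
    = bw (KL, p) b (fun e => bw e c w) + bw (KL, p) c (fun e => bw b e w)).
  { intros u. generalize (bw_jacobi (KL, p) b c u). change (sg (par (KL, p) && par b)) with 1.
    change (fst (br (KL, p) b) * bw (snd (br (KL, p) b)) c u)
      with (bw (KL, p) b (fun e => bw e c u)). intros ->. ring. }
  apply Cx_eq; cbn [cre cim Copp Cmul Cadd RC]; rewrite ?cre_cbw, ?cim_cbw.
  - rewrite (bw_ext b c _ (fun e => bw (KL, p) e (fun e => cre (w e)))) by (intros; apply cre_cbw).
    rewrite J. f_equal; apply bw_ext; intros; symmetry; apply cre_cbw.
  - rewrite (bw_ext b c _ (fun e => bw (KL, p) e (fun e => cim (w e)))) by (intros; apply cim_cbw).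
    rewrite J. f_equal; apply bw_ext; intros; symmetry; apply cim_cbw.
Qed.

Definition cadjT (x : basis) (w : B2 -> Cx) : B2 -> Cx := fun t =>
  Cadd (cbw x (fst t) (fun e => w (e, snd t)))
       (Cmul (sgn (par x && par (fst t))) (cbw x (snd t) (fun e => w (fst t, e)))).

Definition tauT (w : B2 -> Cx) : B2 -> Cx := fun t =>
  Cmul (sgn (par (fst t) && par (snd t))) (w (snd t, fst t)).

Definition xiT (w : B3 -> Cx) : B3 -> Cx := fun t =>
  Cmul (sgn (par (fst (fst t)) && xorb (par (snd (fst t))) (par (snd t))))
       (w (snd (fst t), snd t, fst (fst t))).

Definition cycT (w : B3 -> Cx) : B3 -> Cx := fun t =>
  Cadd (w t) (Cadd (xiT w t) (xiT (xiT w) t)).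

Lemma cpair_adj x w v : cpair w (adj x v) = cpair (cadjT x w) v.
Proof.
  apply cpair_flat_map. intros c [a b]. unfold cadjT, cbw; simpl.
  destruct (br x a), (br x b). rewrite !cpair_cons. unfold cpair; simpl. ring.
Qed.

Lemma cpair_tau w v : cpair w (tau v) = cpair (tauT w) v.
Proof. apply cpair_map. intros c [a b]. unfold tauT; simpl. ring. Qed.

Lemma cpair_xi w v : cpair w (xi v) = cpair (xiT w) v.
Proof. apply cpair_map. intros c [[a b] d]. unfold xiT; simpl. ring. Qed.

Lemma cpair_cyc w v : cpair w (cyc v) = cpair (cycT w) v.
Proof. unfold cyc, cycT. now rewrite !cpair_app, !cpair_xi, !cpair_add. Qed.

Lemma cpair_one_tensor D w v :
  cpair w (one_tensor D v)
  = cpair (fun t => cpair (fun u => w (fst t, fst u, snd u)) (D (snd t))) v.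
Proof.
  apply cpair_flat_map. intros c [a b]; simpl. rewrite <- cpair_scal.
  apply cpair_map. intros c' [x y]; simpl. ring.
Qed.

Lemma sgn_sq b : Cmul (sgn b) (sgn b) = C1.
Proof. destruct b; apply Cx_eq; simpl; ring. Qed.

Lemma tauT_tauT w t : tauT (tauT w) t = w t.
Proof.
  destruct t as [a b]. unfold tauT; simpl. rewrite (andb_comm (par b)).
  transitivity (Cmul (Cmul (sgn (par a && par b)) (sgn (par a && par b))) (w (a, b))); [ring|].
  rewrite sgn_sq. ring.
Qed.

Lemma RC_minus1 : RC (-1) = Copp C1.
Proof. apply Cx_eq; simpl; ring. Qed.

Ltac signs := unfold sgn; simpl; rewrite ?RC_minus1; try ring.

Lemma tauT_cadjT x w t : tauT (cadjT x w) t = cadjT x (tauT w) t.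
Proof.
  destruct t as [a b]. unfold tauT at 1, cadjT; simpl. unfold tauT; simpl.
  rewrite (cbw_par x a (fun v e => Cmul (sgn (v && par b)) (w (b, e)))).
  rewrite (cbw_par x b (fun v e => Cmul (sgn (par a && v)) (w (e, a)))).
  rewrite !cbw_scal. destruct (par x), (par a), (par b); signs.
Qed.

Lemma xiT_cycT w t : xiT (cycT w) t = cycT w t.
Proof.
  destruct t as [[a b] c]. unfold cycT, xiT; simpl.
  destruct (par a), (par b), (par c); signs.
Qed.

(** * The Yang-Baxter equation *)

Definition bilin (F : B2 -> B2 -> Cx) (v v' : vec B2) : Cx :=
  cpair (fun t => cpair (F t) v') v.

(** Asked of the entries and not only of the coefficients, so that two weights can be compared entry
    by entry. *)
Definition even_entries (v : vec B2) : Prop := forall c t, In (c, t) v -> even2 t.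

Definition skew (v : vec B2) : Prop := forall w, cpair (tauT w) v = Copp (cpair w v).

Lemma bilin_ext_even F F' v v' :
  even_entries v -> even_entries v' ->
  (forall a b c d, par b = par a -> par d = par c -> F (a, b) (c, d) = F' (a, b) (c, d)) ->
  bilin F v v' = bilin F' v v'.
Proof.
  intros Hv Hv' H. apply cpair_ext_in. intros k [a b] Hin.
  apply cpair_ext_in. intros k' [c d] Hin'.
  apply H; symmetry; [apply (Hv _ _ Hin)|apply (Hv' _ _ Hin')].
Qed.

Lemma bilin_add F F' v v' :
  bilin (fun t u => Cadd (F t u) (F' t u)) v v' = Cadd (bilin F v v') (bilin F' v v').
Proof.
  unfold bilin. rewrite <- cpair_add. apply cpair_ext. intros. apply cpair_add.
Qed.

Lemma bilin_swap F v v' : bilin F v v' = bilin (fun t u => F u t) v' v.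
Proof. apply cpair_swap. Qed.

Lemma bilin_flip F v v' : skew v ->
  bilin F v v'
  = bilin (fun t u => Copp (Cmul (sgn (par (fst t) && par (snd t))) (F (snd t, fst t) u))) v v'.
Proof.
  intros Hs. unfold bilin.
  transitivity (Copp (cpair (tauT (fun t => cpair (F t) v')) v)).
  - rewrite Hs. ring.
  - transitivity (Cmul (Copp C1) (cpair (tauT (fun t => cpair (F t) v')) v)); [ring|].
    rewrite <- cpair_scal. apply cpair_ext. intros [a b]; unfold tauT; simpl.
    rewrite <- !cpair_scal. apply cpair_ext. intros; ring.
Qed.

Definition tens (w : B3 -> Cx) : B2 -> B2 -> Cx := fun t u =>
  cbw (snd t) (fst u) (fun e => w (fst t, e, snd u)).

Definition cybeT (w : B3 -> Cx) : B2 -> B2 -> Cx := fun t u =>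
  Cadd (Cmul (sgn (par (fst u) && par (snd t))) (cbw (fst t) (fst u) (fun e => w (e, snd t, snd u))))
  (Cadd (tens w t u)
    (Cmul (sgn (par (fst u) && par (snd t))) (cbw (snd t) (snd u) (fun e => w (fst t, fst u, e))))).

Lemma cpair_cybe w r : cpair w (cybe r) = bilin (cybeT w) r r.
Proof.
  apply cpair_flat_map. intros c [a b]. rewrite <- cpair_scal.
  apply cpair_flat_map. intros c' [a' b']. unfold cybeT, tens, cbw; simpl.
  destruct (br a a'), (br b a'), (br b b'). rewrite !cpair_cons. unfold cpair; simpl. ring.
Qed.

(** The bracket e has parity [b] + [c], and [d] = [c], so the exponent [a]([e] + [d]) is [a][b] =
    [a]. *)
Lemma xiT_slot w a b c d : par b = par a -> par d = par c ->
  tens (xiT w) (a, b) (c, d) = Cmul (sgn (par a)) (cbw b c (fun e => w (e, d, a))).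
Proof.
  intros Hb Hd. unfold tens, xiT; simpl.
  rewrite (cbw_par b c (fun v e => Cmul (sgn (par a && xorb v (par d))) (w (e, d, a)))).
  rewrite cbw_scal, Hb, Hd. destruct (par a), (par c); reflexivity.
Qed.

Lemma xiT2_slot w a b c d : par b = par a -> par d = par c ->
  tens (xiT (xiT w)) (a, b) (c, d) = Cmul (sgn (par c)) (cbw b c (fun e => w (d, a, e))).
Proof.
  intros Hb Hd. unfold tens, xiT; simpl.
  rewrite (cbw_par b c (fun v e => Cmul (sgn (par a && xorb v (par d)))
    (Cmul (sgn (v && xorb (par d) (par a))) (w (d, a, e))))).
  rewrite !cbw_scal, Hb, Hd. destruct (par a), (par c); signs.
Qed.

(* Up to the antisymmetry of r, the three terms of c(r) are the cyclic rotations of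
   the middle one. *)
Lemma cybe_cyclic w r : even_entries r -> skew r ->
  cpair w (cybe r) = bilin (tens (cycT w)) r r.
Proof.
  intros He Hs. rewrite cpair_cybe. unfold cybeT. rewrite !bilin_add.
  assert (E : bilin (tens (cycT w)) r r
    = Cadd (bilin (tens w) r r) (Cadd (bilin (tens (xiT w)) r r) (bilin (tens (xiT (xiT w))) r r))).
  { rewrite <- !bilin_add. apply bilin_ext_even; [assumption..|].
    intros. unfold tens, cycT. now rewrite !cbw_add. }
  rewrite E.
  assert (E1 : bilin (tens (xiT w)) r r = bilin (fun t u =>
      Cmul (sgn (par (fst u) && par (snd t)))
        (cbw (fst t) (fst u) (fun e => w (e, snd t, snd u)))) r r).
  (* Flipping the first copy of r turns [b,c] into [a,c]; exchanging the copies and antisymmetry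
     give the first term of c(r). For E2 the copies are exchanged before the flip, which yields the
     third term. *)
  { rewrite (bilin_flip _ r r Hs), bilin_swap. apply bilin_ext_even; [assumption..|].
    intros a b c d Hb Hd. simpl. rewrite xiT_slot by congruence.
    rewrite (cbw_antisym a c), Hb, Hd. destruct (par a), (par c); signs. }
  assert (E2 : bilin (tens (xiT (xiT w))) r r = bilin (fun t u =>
      Cmul (sgn (par (fst u) && par (snd t)))
        (cbw (snd t) (snd u) (fun e => w (fst t, fst u, e)))) r r).
  { rewrite bilin_swap, (bilin_flip _ r r Hs). apply bilin_ext_even; [assumption..|].
    intros a b c d Hb Hd. simpl. rewrite xiT2_slot by congruence.
    rewrite (cbw_antisym b d), Hb, Hd. destruct (par a), (par c); signs. }
  rewrite E1, E2. ring.
Qed.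

(* [w] is the transpose of a cyclic sum: this is the paper's (1+xi+xi^2)(1 (x) Delta_2) r_1
   for the coboundary Delta_2 of r_2, and it is symmetric in r_1 and r_2. *)
Lemma cyclic_one_tensor w r1 r2 :
  even_entries r1 -> even_entries r2 -> skew r1 -> (forall t, xiT w t = w t) ->
  bilin (fun t => cadjT (snd t) (fun u => w (fst t, fst u, snd u))) r1 r2
  = Cadd (bilin (tens w) r1 r2) (bilin (tens w) r2 r1).
Proof.
  intros He1 He2 Hs Hw. unfold cadjT. rewrite bilin_add.
  rewrite (bilin_swap (tens w) r2 r1). f_equal.
  rewrite (bilin_flip _ r1 r2 Hs). apply bilin_ext_even; [assumption..|].
  intros a b c d Hb Hd. unfold tens; simpl.
  rewrite (cbw_ext a d _ (fun e => xiT w (b, c, e))) by (intros; symmetry; apply Hw).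
  unfold xiT; simpl.
  rewrite (cbw_par a d (fun v e => Cmul (sgn (par b && xorb (par c) v)) (w (c, e, b)))).
  rewrite cbw_scal, (cbw_antisym a d), Hb, Hd. destruct (par a), (par c); signs.
Qed.

(** * The action of L_p on the tensor cube *)

Definition cadj3T (p : R) (w : B3 -> Cx) : B3 -> Cx := fun t =>
  Cadd (cbw (KL, p) (fst (fst t)) (fun e => w (e, snd (fst t), snd t)))
  (Cadd (cbw (KL, p) (snd (fst t)) (fun e => w (fst (fst t), e, snd t)))
        (cbw (KL, p) (snd t) (fun e => w (fst (fst t), snd (fst t), e)))).

Lemma cbw_L_par p a (F : bool -> basis -> Cx) :
  cbw (KL, p) a (fun e => F (par e) e) = cbw (KL, p) a (F (par a)).
Proof. exact (cbw_par (KL, p) a F). Qed.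

Lemma cadj3T_xiT p w t : cadj3T p (xiT w) t = xiT (cadj3T p w) t.
Proof.
  destruct t as [[a b] c]. unfold cadj3T, xiT; simpl.
  rewrite (cbw_L_par p a (fun v e => Cmul (sgn (v && xorb (par b) (par c))) (w (b, c, e)))).
  rewrite (cbw_L_par p b (fun v e => Cmul (sgn (par a && xorb v (par c))) (w (e, c, a)))).
  rewrite (cbw_L_par p c (fun v e => Cmul (sgn (par a && xorb (par b) v)) (w (b, e, a)))).
  rewrite !cbw_scal. ring.
Qed.

Lemma xiT_ext w w' t : (forall t, w t = w' t) -> xiT w t = xiT w' t.
Proof. intros H. unfold xiT. now rewrite H. Qed.

Lemma cadj3T_cycT p w t : cycT (cadj3T p w) t = cadj3T p (cycT w) t.
Proof.
  unfold cycT at 1.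
  rewrite (xiT_ext (xiT (cadj3T p w)) (cadj3T p (xiT w)))
    by (intros; symmetry; apply cadj3T_xiT).
  rewrite <- !cadj3T_xiT. unfold cadj3T, cycT. rewrite !cbw_add. ring.
Qed.

(** Leibniz rule for T: on the middle factor [b,c] it is the Jacobi identity, on the outer factors
    the operators commute. *)
Lemma tens_cadj3T p w t u :
  tens (cadj3T p w) t u
  = Cadd (cadjT (KL, p) (fun t' => tens w t' u) t) (cadjT (KL, p) (tens w t) u).
Proof.
  destruct t as [a b], u as [c d]. unfold tens, cadj3T, cadjT; simpl.
  rewrite !cbw_add, cbw_L_jacobi.
  change (sgn (par (KL, p) && _)) with C1.
  change (sgn false) with C1.
  assert (S : forall x, cbw b c (fun e => cbw (KL, p) x (fun e0 => w (e0, e, d)))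
    = cbw (KL, p) x (fun e => cbw b c (fun e0 => w (e, e0, d)))).
  { intros; unfold cbw; ring. }
  assert (S' : cbw b c (fun e => cbw (KL, p) d (fun e0 => w (a, e, e0)))
    = cbw (KL, p) d (fun e => cbw b c (fun e0 => w (a, e0, e)))).
  { unfold cbw; ring. }
  rewrite S, S'. ring.
Qed.

(** As for [invariant_zero]: for large p only the action on the first factor can reach first
    position x + p. *)
Lemma invariant3_zero (e : R) (l : list (R * B3)) :
  0 < e ->
  (forall n, (1 <= n)%Z -> forall w : B3 -> R,
     rpair (fun t => bw (KL, IZR n * e) (fst (fst t)) (fun e => w (e, snd (fst t), snd t))
       + (bw (KL, IZR n * e) (snd (fst t)) (fun e => w (fst (fst t), e, snd t))
       + bw (KL, IZR n * e) (snd t) (fun e => w (fst (fst t), snd (fst t), e)))) l = 0) ->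
  forall w, rpair w l = 0.
Proof.
  intros He H. apply rpair_null. intros [[[X x] b] c].
  destruct (exists_multiple_above e
    (x / wt X :: map (fun c => snd (fst (fst (snd c))) - x) l) He) as (n & Hn & Hbig).
  set (p := IZR n * e) in *.
  assert (Hx : wt X * p - x <> 0).
  { assert (x / wt X < p) by (apply Hbig; now left). assert (A := wt_ge X).
    assert (x = x / wt X * wt X) by (field; lra). nra. }
  apply (Rmult_eq_reg_l (wt X * p - x)); [|assumption].
  rewrite Rmult_0_r, <- rpair_scal, <- (H n Hn (dirac ((X, p + x), b, c))).
  apply rpair_ext_in. intros k [[[X' x'] b'] c'] Hin. fold p. simpl fst; simpl snd.
  assert (Hl : x' - x < p).
  { apply Hbig; right. now apply (in_map (fun c => snd (fst (fst (snd c))) - x)) in Hin. }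
  assert (N : forall b' c', @dirac B3 ((X, p + x), b, c) ((X', x'), b', c') = 0).
  { intros. apply dirac_neq. intros E. inversion E. lra. }
  unfold bw at 2 3. rewrite !N, !Rmult_0_r, !Rplus_0_r.
  replace (bw (KL, p) (X', x') (fun e0 => dirac ((X, p + x), b, c) (e0, b', c')))
    with ((wt X' * p - x') * @dirac B3 ((X, p + x), b, c) ((X', p + x'), b', c'))
    by (unfold bw, wt; destruct X'; simpl; f_equal; field).
  destruct (classic (((X, x), b, c) = ((X', x'), b', c'))) as [E|N'].
  - inversion E; subst. rewrite !dirac_same. ring.
  - rewrite !dirac_neq; [ring| |assumption]. intros E; apply N'. inversion E.
    assert (x = x') by lra. now subst.
Qed.

Lemma cybe_invariant_zero e r : 0 < e ->
  (forall n, (1 <= n)%Z -> forall w, cpair (cadj3T (IZR n * e) w) (cybe r) = C0) ->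
  equiv3 (cybe r) [].
Proof.
  intros He H.
  assert (Z : forall k, component k -> forall w : B3 -> R, rpair w (rpart k (cybe r)) = 0).
  { intros k Hk. apply (invariant3_zero e); [assumption|]. intros n Hn w.
    rewrite rpair_rpart by assumption.
    transitivity (k C0); [f_equal|destruct Hk as [->| ->]; reflexivity].
    rewrite <- (H n Hn (fun t => RC (w t))). apply cpair_ext. intros t.
    unfold cadj3T, cbw, bw. apply Cx_eq; simpl; ring. }
  refine (equiv_cpair B3_eq_dec (cybe r) [] _). intros w. unfold cpair at 2; simpl.
  apply Cx_eq; rewrite ?cre_cpair, ?cim_cpair, !Z; simpl; (ring || (now left) || now right).
Qed.

(** * Valid indices and even tensors *)

Definition valid_even (Gam : R -> Prop) (s : R) (t : B2) : Prop :=
  valid Gam s (fst t) /\ valid Gam s (snd t) /\ even2 t.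

(** Read from left to right, an invalid argument has only invalid brackets, so terms of r outside L
    (x) L cannot contribute to valid pairs. *)
Lemma valid_br Gam s x a : subgroup Gam -> Gam (2 * s) -> valid Gam s x ->
  fst (br x a) <> 0 -> (valid Gam s (snd (br x a)) <-> valid Gam s a).
Proof.
  intros HG H2 Hx Hn.
  assert (S : forall y z, Gam y -> (Gam z <-> Gam (z + y))).
  { intros y z Hy. split; intros Hz; [now apply (subD _ HG)|].
    replace z with (z + y + - y) by ring. apply (subD _ HG); [assumption|now apply (subN _ HG)]. }
  destruct x as [[] p], a as [[] q]; unfold valid in *; simpl in *; try (now elim Hn);
    symmetry;
    (let go y z := (rewrite (S y z) by assumption) in
     match goal with
     | Hp : _ p |- _ <-> _ (p + q - s) => go p (q - s)
     | Hp : _ p |- _ => go p q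
     | Hp : _ (p - s) |- _ (q - s) <-> _ => go (p - s) (q - s); rewrite (S (2 * s)) by assumption
     | Hp : _ (p - s) |- _ => go (p - s) q
     end);
    match goal with |- _ ?u <-> _ ?v => replace u with v by ring; tauto end.
Qed.

Lemma cadjT_ext_valid Gam s x w w' t :
  subgroup Gam -> Gam (2 * s) -> valid Gam s x ->
  (forall u, valid Gam s (fst u) /\ valid Gam s (snd u)
             /\ xorb (par (fst u)) (par (snd u)) = par x -> w u = w' u) ->
  valid_even Gam s t -> cadjT x w t = cadjT x w' t.
Proof.
  intros HG H2 Hx Hw (Va & Vb & He). destruct t as [a b]. unfold even2 in He. simpl in *.
  assert (P : forall c, fst (br x c) <> 0 -> par (snd (br x c)) = xorb (par x) (par c)).
  { intros c. destruct x as [[] p], c as [[] q]; unfold par; simpl; tauto. }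
  assert (Z : RC 0 = C0) by reflexivity.
  unfold cadjT; simpl. f_equal; [|f_equal]; unfold cbw.
  - destruct (Req_dec (fst (br x a)) 0) as [->|N]; [rewrite Z; ring|].
    f_equal. apply Hw. simpl. rewrite valid_br, P, He by assumption.
    repeat split; [assumption..|destruct (par x), (par b); reflexivity].
  - destruct (Req_dec (fst (br x b)) 0) as [->|N]; [rewrite Z; ring|].
    f_equal. apply Hw. simpl. rewrite valid_br, P, He by assumption.
    repeat split; [assumption..|destruct (par x), (par b); reflexivity].
Qed.

Lemma cre_cadjT x w t : cre (cadjT x w t) = adjT x (fun t => cre (w t)) t.
Proof. unfold cadjT, adjT, cbw, bw. rewrite sgn_RC. simpl. ring. Qed.

Lemma cim_cadjT x w t : cim (cadjT x w t) = adjT x (fun t => cim (w t)) t.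
Proof. unfold cadjT, adjT, cbw, bw. rewrite sgn_RC. simpl. ring. Qed.

(** * Lie super-bialgebra structures *)

(** The structure constants and signs are real, so testing against real weights splits the complex
    identity into one for each component. *)
Lemma bialgebra_real_cocycle Gam s D k : component k ->
  is_lie_super_bialgebra Gam s D -> real_cocycle Gam s (fun b => rpart k (D b)).
Proof.
  intros Hk [_ HD] x y Hx Hy w. rewrite !rpair_rpart by assumption.
  assert (E := cpair_equiv B2_eq_dec _ _ (HD x y Hx Hy) (fun t => RC (w t))).
  unfold Delta_br in E. rewrite cpair_scale, cpair_vsub, cpair_scale, !cpair_adj in E.
  assert (A : forall z v, cpair (cadjT z (fun t => RC (w t))) v
                            = cpair (fun t => RC (adjT z w t)) v).
  { intros z v. apply cpair_ext. intros t.
    apply Cx_eq; [rewrite cre_cadjT|rewrite cim_cadjT]; simpl; [reflexivity|].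
    unfold adjT, bw. ring. }
  rewrite !A, sgn_RC in E. apply (f_equal k) in E.
  destruct Hk as [->| ->]; simpl in E; lra.
Qed.

Lemma bialgebra_even Gam s D k : component k -> is_lie_super_bialgebra Gam s D ->
  forall p, Gam p -> supp even2 (rpart k (D (KL, p))).
Proof.
  intros Hk [(_ & Hh & _) _] p Hp. apply (rpart_supp B2_eq_dec); [assumption|].
  intros [a b] Hab. specialize (Hh (KL, p) Hp a b Hab). unfold even2; simpl.
  change (par (KL, p)) with false in Hh.
  destruct (par a), (par b); simpl in Hh; congruence.
Qed.

Lemma bialgebra_inner Gam s D :
  subgroup Gam -> Gam (2 * s) -> (exists p, Gam p /\ p <> 0) ->
  is_lie_super_bialgebra Gam s D ->
  exists r : vec B2, forall x, valid Gam s x -> forall w,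
    cpair w (D x) = cpair (cadjT x w) r.
Proof.
  intros HG H2 Hne HD.
  assert (Hre : component cre) by now left.
  assert (Him : component cim) by now right.
  destruct (real_cocycle_inner Gam s _ HG H2 Hne (bialgebra_real_cocycle Gam s D cre Hre HD)
    (bialgebra_even Gam s D cre Hre HD)) as [r1 H1].
  destruct (real_cocycle_inner Gam s _ HG H2 Hne (bialgebra_real_cocycle Gam s D cim Him HD)
    (bialgebra_even Gam s D cim Him HD)) as [r2 H2'].
  set (r := map (fun e => (mkCx (fst e) 0, snd e)) r1 ++ map (fun e => (mkCx 0 (fst e), snd e)) r2).
  assert (Hr : forall w, rpair w (rpart cre r) = rpair w r1 /\ rpair w (rpart cim r) = rpair w r2).
  { intros w. unfold r, rpart. rewrite !map_app, !map_map, !rpair_app; simpl.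
    assert (I : forall l : list (R * B2), map (fun e => (fst e, snd e)) l = l).
    { intros l. rewrite <- (map_id l) at 2. apply map_ext. now intros []. }
    assert (O : forall l : list (R * B2), rpair w (map (fun e => (0, snd e)) l) = 0).
    { induction l as [|e l IH]; [reflexivity|]. simpl map. rewrite rpair_cons, IH. ring. }
    rewrite !I, !O. split; ring. }
  exists r. intros x Hx w.
  apply Cx_eq; rewrite ?cre_cpair, ?cim_cpair.
  - rewrite (rpair_ext (fun t => cre (cadjT x w t)) _ _ (cre_cadjT x w)).
    rewrite (rpair_ext (fun t => cim (cadjT x w t)) _ _ (cim_cadjT x w)).
    rewrite !(proj1 (Hr _)), !(proj2 (Hr _)). f_equal; [apply H1|apply H2']; assumption.
  - rewrite (rpair_ext (fun t => cre (cadjT x w t)) _ _ (cre_cadjT x w)).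
    rewrite (rpair_ext (fun t => cim (cadjT x w t)) _ _ (cim_cadjT x w)).
    rewrite !(proj1 (Hr _)), !(proj2 (Hr _)). f_equal; [apply H2'|apply H1]; assumption.
Qed.

Definition all_valid_even (Gam : R -> Prop) (s : R) (v : vec B2) : Prop :=
  forall c t, In (c, t) v -> valid_even Gam s t.

Definition restrict (P : B2 -> Prop) (v : vec B2) : vec B2 :=
  filter (fun e => if excluded_middle_informative (P (snd e)) then true else false) v.

Lemma cpair_restrict P w v :
  cpair w (restrict P v)
  = cpair (fun t => if excluded_middle_informative (P t) then w t else C0) v.
Proof.
  induction v as [|[c t] v IH]; [reflexivity|].
  rewrite cpair_cons, <- IH. unfold restrict; simpl.
  destruct (excluded_middle_informative (P t)); [reflexivity|ring].
Qed.

(** The r obtained so far may have terms outside L (x) L or of odd parity. D x only sees weights on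
    valid pairs of the parity of x, and on such weights the discarded terms of r pair to 0. *)
Lemma bialgebra_inner_valid Gam s D :
  subgroup Gam -> Gam (2 * s) -> (exists p, Gam p /\ p <> 0) ->
  is_lie_super_bialgebra Gam s D ->
  exists r : vec B2, all_valid_even Gam s r /\ forall x, valid Gam s x -> forall w,
    cpair w (D x) = cpair (cadjT x w) r.
Proof.
  intros HG H2 Hne HD. destruct (bialgebra_inner Gam s D HG H2 Hne HD) as [r Hr].
  exists (restrict (valid_even Gam s) r). split.
  - intros c t Hin. apply filter_In in Hin. destruct Hin as [_ Hin]. simpl in Hin.
    destruct (excluded_middle_informative _); [assumption|discriminate].
  - intros x Hx w. rewrite cpair_restrict.
    set (V := fun u : B2 => valid Gam s (fst u) /\ valid Gam s (snd u)
                            /\ xorb (par (fst u)) (par (snd u)) = par x).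
    set (w' := fun u => if excluded_middle_informative (V u) then w u else C0).
    transitivity (cpair w' (D x)).
    { apply (cpair_supp B2_eq_dec). intros [a b] Hab. unfold w'.
      destruct (excluded_middle_informative (V (a, b))) as [|N]; [reflexivity|].
      exfalso. apply N. destruct HD as [(Hv & Hh & _) _].
      destruct (Hv x Hx a b Hab). repeat split; try assumption. now apply (Hh x Hx). }
    rewrite Hr by assumption. apply cpair_ext. intros [a b].
    destruct (excluded_middle_informative (valid_even Gam s (a, b))) as [Hab|N].
    + apply (cadjT_ext_valid Gam s); try assumption. intros u Hu. unfold w'.
      destruct (excluded_middle_informative (V u)); [reflexivity|contradiction].
    + assert (Z : RC 0 = C0) by reflexivity.
      assert (P : forall c, fst (br x c) <> 0 -> par (snd (br x c)) = xorb (par x) (par c)).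
      { intros c. destruct x as [[] p], c as [[] q]; unfold par; simpl; tauto. }
      assert (X : forall u v y, xorb u v = y -> xorb y u = v) by (now intros [] [] []).
      unfold cadjT, cbw; simpl.
      assert (T1 : Cmul (RC (fst (br x a))) (w' (snd (br x a), b)) = C0).
      { destruct (Req_dec (fst (br x a)) 0) as [->|Na]; [rewrite Z; ring|].
        unfold w'. destruct (excluded_middle_informative _) as [(V1 & V2 & V3)|]; [|ring].
        exfalso. apply N. simpl in *. rewrite P in V3 by assumption.
        apply valid_br in V1; try assumption. repeat split; try assumption.
        unfold even2; simpl. destruct (par x), (par a), (par b); simpl in *; congruence. }
      assert (T2 : Cmul (RC (fst (br x b))) (w' (a, snd (br x b))) = C0).
      { destruct (Req_dec (fst (br x b)) 0) as [->|Na]; [rewrite Z; ring|].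
        unfold w'. destruct (excluded_middle_informative _) as [(V1 & V2 & V3)|]; [|ring].
        exfalso. apply N. simpl in *. rewrite P in V3 by assumption.
        apply valid_br in V2; try assumption. repeat split; try assumption.
        unfold even2; simpl. destruct (par x), (par a), (par b); simpl in *; congruence. }
      rewrite T1, T2. ring.
Qed.

Lemma all_valid_even_scale Gam s k v :
  all_valid_even Gam s v -> all_valid_even Gam s (scale k v).
Proof.
  intros H c t Hin. apply in_map_iff in Hin. destruct Hin as ([c' t'] & E & Hin).
  inversion E; subst. exact (H _ _ Hin).
Qed.

Lemma all_valid_even_tau Gam s v :
  all_valid_even Gam s v -> all_valid_even Gam s (tau v).
Proof.
  intros H c t Hin. apply in_map_iff in Hin. destruct Hin as ([c' [a b]] & E & Hin).
  inversion E; subst. destruct (H _ _ Hin) as (? & ? & ?). repeat split; try assumption.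
  unfold even2 in *; simpl in *; congruence.
Qed.

Lemma all_valid_even_app Gam s v v' :
  all_valid_even Gam s v -> all_valid_even Gam s v' -> all_valid_even Gam s (v ++ v').
Proof. intros H H' c t Hin. apply in_app_or in Hin. destruct Hin; eauto. Qed.

Lemma all_valid_even_adj Gam s p v :
  subgroup Gam -> Gam p -> all_valid_even Gam s v -> all_valid_even Gam s (adj (KL, p) v).
Proof.
  intros HG Hp H c t Hin. apply in_flat_map in Hin.
  destruct Hin as ([c' [a b]] & Hin & Ht). destruct (H _ _ Hin) as (Va & Vb & He).
  assert (S : forall z, valid Gam s z -> valid Gam s (snd (br (KL, p) z))
                        /\ par (snd (br (KL, p) z)) = par z).
  { intros [[] q] Hz; unfold valid, par in *; simpl in *; split; try reflexivity;
      try (now apply (subD _ HG));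
      (replace (p + q - s) with (p + (q - s)) by ring; now apply (subD _ HG)). }
  destruct (S a Va) as [Sa Pa], (S b Vb) as [Sb Pb].
  destruct (br (KL, p) a) as [k1 e1], (br (KL, p) b) as [k2 e2].
  unfold even2 in *; simpl in *.
  destruct Ht as [E|[E|[]]]; inversion E; subst; repeat split; simpl; try assumption;
    unfold even2; simpl; congruence.
Qed.

Lemma all_valid_even_in_LL Gam s v : all_valid_even Gam s v -> in_LL Gam s v.
Proof.
  intros H a b Hab. destruct (coef_in _ _ _ Hab) as [c Hin].
  destruct (H _ _ Hin) as (? & ? & _). now split.
Qed.

Lemma all_valid_even_homog Gam s v : all_valid_even Gam s v -> homog2 v false.
Proof.
  intros H a b Hab. destruct (coef_in _ _ _ Hab) as [c Hin].
  destruct (H _ _ Hin) as (_ & _ & He). unfold even2 in He; simpl in He.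
  rewrite He. apply xorb_nilpotent.
Qed.

Lemma all_valid_even_even Gam s v : all_valid_even Gam s v -> even_entries v.
Proof. intros H c t Hin. apply (H _ _ Hin). Qed.

Lemma skew_1_tau u : skew (vsub u (tau u)).
Proof.
  intros w. rewrite !cpair_vsub, !cpair_tau.
  rewrite (cpair_ext (tauT (tauT w)) w) by apply tauT_tauT. ring.
Qed.

Lemma skew_adj x v : skew v -> skew (adj x v).
Proof.
  intros H w. rewrite !cpair_adj.
  rewrite (cpair_ext (cadjT x (tauT w)) (tauT (cadjT x w)))
    by (intros; symmetry; apply tauT_cadjT).
  apply H.
Qed.

Lemma bialgebra_skew Gam s D x w :
  is_lie_super_bialgebra Gam s D -> valid Gam s x ->
  cpair (tauT w) (D x) = Copp (cpair w (D x)).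
Proof.
  intros [(_ & _ & Ht & _) _] Hx. destruct (Ht x Hx) as (u & _ & Hu).
  rewrite !(cpair_equiv B2_eq_dec _ _ Hu). apply skew_1_tau.
Qed.

(* L_p o c(r) = cyc(T(L_p o r, r) + T(r, L_p o r)) is the cyclic sum of
   (1 (x) Delta) Delta(L_p), which vanishes by co-Jacobi. *)
Lemma cybe_invariant Gam s D r p w :
  subgroup Gam -> is_lie_super_bialgebra Gam s D -> Gam p ->
  all_valid_even Gam s r -> skew r ->
  (forall x, valid Gam s x -> forall w, cpair w (D x) = cpair (cadjT x w) r) ->
  cpair (cadj3T p w) (cybe r) = C0.
Proof.
  intros HG HD Hp Hv Hs Hr.
  assert (He := all_valid_even_even _ _ _ Hv).
  assert (Hv' := all_valid_even_adj Gam s p r HG Hp Hv).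
  rewrite cybe_cyclic by assumption.
  assert (E : bilin (tens (cycT (cadj3T p w))) r r
    = Cadd (bilin (tens (cycT w)) (adj (KL, p) r) r) (bilin (tens (cycT w)) r (adj (KL, p) r))).
  { transitivity (bilin (fun t u => Cadd (cadjT (KL, p) (fun t' => tens (cycT w) t' u) t)
                                         (cadjT (KL, p) (tens (cycT w) t) u)) r r).
    - apply cpair_ext; intros t. apply cpair_ext; intros u.
      rewrite <- tens_cadj3T. apply cbw_ext. intros; apply cadj3T_cycT.
    - rewrite bilin_add. f_equal.
      + rewrite bilin_swap, (bilin_swap _ (adj (KL, p) r)). unfold bilin.
        apply cpair_ext. intros u. now rewrite cpair_adj.
      + unfold bilin. apply cpair_ext. intros t. now rewrite cpair_adj. }
  rewrite E, <- cyclic_one_tensor;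
    [|now apply (all_valid_even_even Gam s)|assumption|now apply skew_adj|apply xiT_cycT].
  destruct HD as [(_ & _ & _ & HJ) _].
  generalize (cpair_equiv B3_eq_dec _ _ (HJ (KL, p) Hp) w).
  rewrite cpair_cyc, cpair_one_tensor. intros EJ.
  (* Delta is replaced by the action on r twice: at L_p, and then at the second factor of each entry
     of L_p o r, which is valid. *)
  refine (eq_trans _ EJ). rewrite Hr, <- cpair_adj by exact Hp.
  apply cpair_ext_in. intros c [a b] Hin. destruct (Hv' _ _ Hin) as (_ & Vb & _).
  simpl. now rewrite Hr.
Qed.

Theorem mainTheorem2 :
  forall (Gam : R -> Prop) (s : R),
    Gam 0 ->
    (forall x y, Gam x -> Gam y -> Gam (x + y)) ->
    (forall x, Gam x -> Gam (- x)) ->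
    (exists p, Gam p /\ p <> 0) ->
    Gam (2 * s) ->
    forall D : comult,
      is_lie_super_bialgebra Gam s D ->
      is_triangular_coboundary Gam s D.
Proof.
  intros Gam s G0 GD GN Hne H2 D HD.
  assert (HG : subgroup Gam) by (constructor; assumption).
  destruct (bialgebra_inner_valid Gam s D HG H2 Hne HD) as (r0 & Hv0 & Hr0).
  (* r = (r0 - tau r0) / 2 induces the same Delta, because tau commutes with the action and every
     Delta(x) is skew. *)
  set (u := scale (RC (/ 2)) r0).
  assert (Hu : all_valid_even Gam s u) by (now apply all_valid_even_scale).
  set (r := vsub u (tau u)).
  assert (Hv : all_valid_even Gam s r).
  { apply all_valid_even_app; [assumption|].
    now apply all_valid_even_scale, all_valid_even_tau. }
  assert (Hs : skew r) by apply skew_1_tau.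
  assert (Hr : forall x, valid Gam s x -> forall w, cpair w (D x) = cpair (cadjT x w) r).
  { intros x Hx w. unfold r, u. rewrite cpair_vsub, cpair_tau, !cpair_scale.
    rewrite (cpair_ext (tauT (cadjT x w)) (cadjT x (tauT w))) by apply tauT_cadjT.
    rewrite <- !Hr0, (bialgebra_skew Gam s D x w HD Hx) by assumption.
    apply Cx_eq; simpl; field. }
  exists r, false. repeat split.
  - now apply (all_valid_even_in_LL Gam s r Hv a b).
  - now apply (all_valid_even_in_LL Gam s r Hv a b).
  - now apply (all_valid_even_homog Gam s).
  - exists u. split; [now apply all_valid_even_in_LL|intros t; reflexivity].
  - intros x Hx. refine (equiv_cpair B2_eq_dec _ _ _). intros w.
    rewrite cpair_scale, cpair_adj, Hr by assumption. simpl. ring.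
  - assert (He : exists e, Gam e /\ 0 < e).
    { destruct Hne as (p & Gp & Np). destruct (Rlt_le_dec 0 p); [now exists p|].
      exists (- p). split; [now apply GN|lra]. }
    destruct He as (e & Ge & He). apply (cybe_invariant_zero e r He).
    intros n _ w. apply (cybe_invariant Gam s D); try assumption.
    now apply subgroup_mult.
Qed.
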